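(* Let $f\colon M\rightarrow\mathbb{R}^{5}$ be a non-degenerate affine hypersurface ($\dim M=4$) with a locally equiaffine transversal vector field $\xi$ and an almost symplectic form $\omega$ on $M$. Let $\nabla$, $h$, $S$ be the induced connection, the second fundamental form and the shape operator induced by $\xi$. If $\nabla^k\omega=0$ for some integer $k\geq 1$ and the second fundamental form $h$ is Lorentzian on $M$ (that is, has signature $(3,1)$), then the shape operator $S$ has rank $\leq 1$ (at every point of $M$).
   Context: $M$ is a connected orientable smooth $4$-manifold immersed by $f$ in $\mathbb{R}^5$, and $\operatorname{D}$ is the usual flat connection on $\mathbb{R}^5$. For a transversal vector field $\xi$ along $f$, the induced connection $\nabla$ (torsion-free), the second fundamental form $h$ (a symmetric bilinear form), the shape operator $S$ (a $(1,1)$-tensor) and the transversal connection form $\tau$ (a 1-form) are defined by $\operatorname{D}_Xf_*Y=f_*(\nabla_XY)+h(X,Y)\xi$ and $\operatorname{D}_X\xi=-f_*(SX)+\tau(X)\xi$ for tangent vector fields $X,Y$. The vector field $\xi$ is called locally equiaffine if $d\tau=0$. The hypersurface is non-degenerate if $h$ is non-degenerate. An almost symplectic form is a non-degenerate 2-form on $M$ (not necessarily closed). For a tensor field $T$ of type $(0,p)$, $\nabla T$ is the tensor field of type $(0,p+1)$ given by $(\nabla T)(X_1,\ldots,X_{p+1})=X_1(T(X_2,\ldots,X_{p+1}))-\sum_{i=2}^{p+1}T(X_2,\ldots,\nabla_{X_1}X_i,\ldots,X_{p+1})$; higher order derivatives are defined by $\nabla^0T=T$, $\nabla^{k+1}T=\nabla(\nabla^kT)$.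 *)

(* Defs.v *)
From HB Require Import structures.
From mathcomp Require Import all_boot all_order all_algebra.
From mathcomp Require Import all_classical all_reals all_analysis.

Set Implicit Arguments.
Unset Strict Implicit.
Unset Printing Implicit Defensive.

Import Order.TTheory GRing.Theory Num.Theory numFieldNormedType.Exports.

Local Open Scope classical_set_scope.
Local Open Scope ring_scope.

(* Coordinates and tangent vectors are row vectors.  The Jacobian 'J t x acts
   on the right: 'd t x v = v *m 'J t x. *)

Section Smooth.
Variables (R : realType) (V W : normedModType R).

(* Meant for open U only: differentiability and derivatives at the points of U
   then do not depend on the values of g outside U. *)
Fixpoint Ck_on (k : nat) (U : set V) (g : V -> W) : Prop :=
  if k is k'.+1 then
    (forall x, U x -> differentiable g x) /\
    (forall v, Ck_on k' U (fun x => 'D_v g x))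
  else forall x, U x -> {for x, continuous g}.

Definition smooth_on (U : set V) (g : V -> W) : Prop :=
  forall k, Ck_on k U g.

End Smooth.

Section Manifold.
Variables (R : realType) (n : nat).
Local Notation E := 'rV[R]_n.

(* A homeomorphism from an open subset of M onto an open subset of R^n; the
   values of chart_map outside chart_dom, and of its inverse chart_par outside
   the image of chart_dom, are irrelevant. *)
Record chart (M : topologicalType) := Chart {
  chart_dom : set M;
  chart_map : M -> E;
  chart_par : E -> M;
  chart_dom_open : open chart_dom;
  chart_img_open : open (chart_map @` chart_dom);
  chart_mapK : forall p, chart_dom p -> chart_par (chart_map p) = p;
  chart_map_cont : forall p, chart_dom p -> {for p, continuous chart_map};
  chart_par_cont : forall x, (chart_map @` chart_dom) x ->
    {for x, continuous chart_par} }.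

Definition chart_img (M : topologicalType) (phi : chart M) : set E :=
  chart_map phi @` chart_dom phi.

Definition overlap (M : topologicalType) (phi psi : chart M) : set E :=
  chart_map phi @` (chart_dom phi `&` chart_dom psi).

Definition transition (M : topologicalType) (phi psi : chart M) : E -> E :=
  chart_map psi \o chart_par phi.

Definition compatible (M : topologicalType) (phi psi : chart M) : Prop :=
  smooth_on (overlap phi psi) (transition phi psi) /\
  smooth_on (overlap psi phi) (transition psi phi).

Record manifold := Manifold {
  carrier :> topologicalType;
  manifold_hausdorff : hausdorff_space carrier;
  manifold_second_countable : @second_countable carrier;
  atlas : set (chart carrier);
  atlas_cover : forall p : carrier, exists2 phi, atlas phi & chart_dom phi p;
  atlas_compatible : forall phi psi, atlas phi -> atlas psi ->
    compatible phi psi;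
  atlas_maximal : forall phi, (forall psi, atlas psi -> compatible phi psi) ->
    atlas phi }.

Definition orientable (M : manifold) : Prop :=
  exists B : set (chart M),
    [/\ B `<=` @atlas M,
        forall p : M, exists2 phi, B phi & chart_dom phi p
      & forall phi psi, B phi -> B psi -> forall x, overlap phi psi x ->
          0 < \det ('J (transition phi psi) x)].

Definition smooth_map (M : manifold) (W : normedModType R) (g : M -> W) :=
  forall phi, atlas phi -> smooth_on (chart_img phi) (g \o chart_par phi).

(* Tensor fields are given by their components in each chart of the atlas:
   a bilinear form is v, w |-> v *m A *m w^T, a linear form is v |-> v *m a, an
   endomorphism is v |-> v *m S. *)

Definition bform (A : 'M[R]_n) (v w : E) : R := (v *m A *m w^T) 0 0.
Definition lform (a : 'cV[R]_n) (v : E) : R := (v *m a) 0 0.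

Record bilinear_field (M : manifold) := BilinearField {
  bilinear_mx :> chart M -> E -> 'M[R]_n;
  bilinear_smooth : forall phi, atlas phi ->
    smooth_on (chart_img phi) (bilinear_mx phi);
  bilinear_transition : forall phi psi, atlas phi -> atlas psi ->
    forall x, overlap phi psi x ->
      let J := 'J (transition phi psi) x in
      bilinear_mx phi x = J *m bilinear_mx psi (transition phi psi x) *m J^T }.

Record endo_field (M : manifold) := EndoField {
  endo_mx :> chart M -> E -> 'M[R]_n;
  endo_smooth : forall phi, atlas phi ->
    smooth_on (chart_img phi) (endo_mx phi);
  endo_transition : forall phi psi, atlas phi -> atlas psi ->
    forall x, overlap phi psi x ->
      let J := 'J (transition phi psi) x in
      endo_mx phi x *m J = J *m endo_mx psi (transition phi psi x) }.

Record one_form (M : manifold) := OneForm {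
  one_form_mx :> chart M -> E -> 'cV[R]_n;
  one_form_smooth : forall phi, atlas phi ->
    smooth_on (chart_img phi) (one_form_mx phi);
  one_form_transition : forall phi psi, atlas phi -> atlas psi ->
    forall x, overlap phi psi x ->
      one_form_mx phi x =
      'J (transition phi psi) x *m one_form_mx psi (transition phi psi x) }.

Definition closed_one_form (M : manifold) (tau : one_form M) : Prop :=
  forall phi, atlas phi -> forall x, chart_img phi x -> forall i j : 'I_n,
    'D_(delta_mx 0 i) (fun y => tau phi y j 0) x
    - 'D_(delta_mx 0 j) (fun y => tau phi y i 0) x = 0.

Definition nondegenerate_form (A : 'M[R]_n) : Prop :=
  forall v, (forall w, bform A v w = 0) -> v = 0.

Definition nondegenerate_field (M : manifold) (h : bilinear_field M) : Prop :=
  forall phi, atlas phi -> forall x, chart_img phi x ->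
    nondegenerate_form (h phi x).

Definition almost_symplectic (M : manifold) (w : bilinear_field M) : Prop :=
  (forall phi, atlas phi -> forall x, chart_img phi x ->
     forall v, bform (w phi x) v v = 0) /\
  nondegenerate_field w.

(* Vector fields on the domain of a chart, written in its coordinates. *)
Definition vfield (U : set E) (X : E -> E) : Prop := smooth_on U X.

(* X, in the coordinates of phi, and X', in those of psi, are the same vector
   field over the subset D of overlap phi psi. *)
Definition same_vfield (M : manifold) (phi psi : chart M) (D : set E)
    (X X' : E -> E) : Prop :=
  forall x, D x -> X' (transition phi psi x) = 'd (transition phi psi) x (X x).

(* An affine connection, given on the vector fields over chart domains; the
   last axiom expresses both locality and invariance under change of chart. *)
Record connection (M : manifold) := Connection {
  nabla :> chart M -> (E -> E) -> (E -> E) -> (E -> E);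
  nabla_smooth : forall phi X Y, atlas phi ->
    vfield (chart_img phi) X -> vfield (chart_img phi) Y ->
    vfield (chart_img phi) (nabla phi X Y);
  nabla_linear : forall phi (a : E -> R) X X' Y, atlas phi ->
    smooth_on (chart_img phi) a -> vfield (chart_img phi) X ->
    vfield (chart_img phi) X' -> vfield (chart_img phi) Y ->
    forall x, chart_img phi x ->
      nabla phi (fun y => a y *: X y + X' y) Y x
      = a x *: nabla phi X Y x + nabla phi X' Y x;
  nabla_leibniz : forall phi (a : E -> R) X Y Y', atlas phi ->
    smooth_on (chart_img phi) a -> vfield (chart_img phi) X ->
    vfield (chart_img phi) Y -> vfield (chart_img phi) Y' ->
    forall x, chart_img phi x ->
      nabla phi X (fun y => a y *: Y y + Y' y) x
      = 'D_(X x) a x *: Y x + a x *: nabla phi X Y x + nabla phi X Y' x;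
  nabla_transition : forall phi psi (D : set E) X Y X' Y',
    atlas phi -> atlas psi -> open D -> D `<=` overlap phi psi ->
    vfield (chart_img phi) X -> vfield (chart_img phi) Y ->
    vfield (chart_img psi) X' -> vfield (chart_img psi) Y' ->
    same_vfield phi psi D X X' -> same_vfield phi psi D Y Y' ->
    same_vfield phi psi D (nabla phi X Y) (nabla psi X' Y') }.

(* A (0,p)-tensor field over a chart domain, as a function of p vector fields. *)
Definition cov_field (p : nat) := ('I_p -> E -> E) -> E -> R.

Definition two_tensor (A : E -> 'M[R]_n) : cov_field 2 :=
  fun X x => bform (A x) (X ord0 x) (X ord_max x).

(* (nabla T)(X_1, ..., X_(p+1)) = X_1 (T (X_2, ..., X_(p+1)))
     - \sum_i T (X_2, ..., nabla_(X_1) X_i, ..., X_(p+1)) *)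
Definition nabla_tensor (nab : (E -> E) -> (E -> E) -> (E -> E)) (p : nat)
    (T : cov_field p) : cov_field p.+1 := fun X x =>
  let Y := fun i => X (lift ord0 i) in
  'D_(X ord0 x) (T Y) x
  - \sum_(i < p) T (fun j => if j == i then nab (X ord0) (Y i) else Y j) x.

Fixpoint iter_nabla_tensor (nab : (E -> E) -> (E -> E) -> (E -> E))
    (p k : nat) (T : cov_field p) : cov_field (k + p) :=
  match k return cov_field (k + p) with
  | 0 => T
  | k'.+1 => nabla_tensor nab (@iter_nabla_tensor nab p k' T)
  end.

Definition iter_nabla_vanishes (M : manifold) (nab : connection M)
    (w : bilinear_field M) (k : nat) : Prop :=
  forall phi, atlas phi -> forall X : 'I_(k + 2) -> E -> E,
    (forall i, vfield (chart_img phi) (X i)) ->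
    forall x, chart_img phi x ->
      @iter_nabla_tensor (nab phi) 2 k (two_tensor (w phi)) X x = 0.

Definition immersion (M : manifold) (m : nat) (f : M -> 'rV[R]_m) : Prop :=
  smooth_map f /\
  forall phi, atlas phi -> forall x, chart_img phi x ->
    injective ('d (f \o chart_par phi) x).

(* R^(n+1) is the sum of f_*(T_p M) and the line spanned by xi p; for an
   immersion f the sum is direct because the dimensions add up. *)
Definition transversal_field (M : manifold) (f xi : M -> 'rV[R]_n.+1) : Prop :=
  smooth_map xi /\
  forall phi, atlas phi -> forall x, chart_img phi x ->
    forall u : 'rV[R]_n.+1, exists v c,
      u = 'd (f \o chart_par phi) x v + c *: xi (chart_par phi x).

(* D_X f_*Y = f_*(nabla_X Y) + h(X,Y) xi *)
Definition gauss_formula (M : manifold) (f xi : M -> 'rV[R]_n.+1)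
    (nab : connection M) (h : bilinear_field M) : Prop :=
  forall phi, atlas phi -> forall X Y,
    vfield (chart_img phi) X -> vfield (chart_img phi) Y ->
    forall x, chart_img phi x ->
      let F := f \o chart_par phi in
      'D_(X x) (fun y => 'd F y (Y y)) x
      = 'd F x (nab phi X Y x)
        + bform (h phi x) (X x) (Y x) *: xi (chart_par phi x).

(* D_X xi = - f_*(S X) + tau(X) xi *)
Definition weingarten_formula (M : manifold) (f xi : M -> 'rV[R]_n.+1)
    (S : endo_field M) (tau : one_form M) : Prop :=
  forall phi, atlas phi -> forall X, vfield (chart_img phi) X ->
    forall x, chart_img phi x ->
      'D_(X x) (xi \o chart_par phi) x
      = - 'd (f \o chart_par phi) x (X x *m S phi x)
        + lform (tau phi x) (X x) *: xi (chart_par phi x).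

End Manifold.

(* In a suitable basis the form is diag(1, ..., 1, -1, ..., -1). *)
Definition has_signature (R : realType) (p q : nat) (A : 'M[R]_(p + q)) :=
  exists2 P : 'M[R]_(p + q), P \in unitmx &
    P *m A *m P^T = block_mx 1%:M 0 0 (- 1%:M).

Definition lorentzian (R : realType) (M : manifold R 4)
    (h : bilinear_field M) : Prop :=
  forall phi, atlas phi -> forall x, chart_img phi x ->
    @has_signature R 3 1 (h phi x).

(* Main.v *)
(* The Ricci identity turns nabla^k omega = 0 into the pointwise equation R^l omega = 0
   for all large l, where R acts as a derivation on all the slots, the earlier pairs of
   arguments included; by the Gauss equation R(X, Y)Z = h(Y, Z) SX - h(X, Z) SY, and
   d tau = 0 makes S self-adjoint for h. The rest is algebra at one point. If X, Y and the
   other arguments are eigenvectors of R(X, Y), then R^l omega on l copies of (X, Y) is a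
   product of weights times a component of omega, which must therefore vanish.

   If S has a non-real eigenvalue, such components contradict the non-degeneracy of
   omega. If S has an orthogonal basis of eigenvectors, then omega(e, .) = 0 for every
   eigenvector e with a nonzero eigenvalue, so that S = 0. Otherwise S has a null
   eigenvector n. The boosts of a null plane containing n degenerate S to its diagonal
   part and omega to its leading part, which reduces this case to the preceding one,
   unless S is nilpotent; a nilpotent S of rank 2 is excluded directly, and the others
   have rank at most 1. *)
Require Import Defs.
From HB Require Import structures.
From mathcomp Require Import all_boot all_order all_algebra.
From mathcomp Require Import perm complex.
From mathcomp Require Import all_classical all_reals all_analysis.
From mathcomp Require Import ring lra zify.

Set Implicit Arguments.
Unset Strict Implicit.
Unset Printing Implicit Defensive.

Import Order.TTheory GRing.Theory Num.Theory numFieldNormedType.Exports.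

Local Open Scope classical_set_scope.
Local Open Scope ring_scope.

(** * The tensors R^m . w *)

Section Slots.
Variable V : Type.
Implicit Type s : nat -> V.

(** The difficulty is that R^l omega is not a power of one operator applied to omega: R(X, Y) also
    acts on the arguments of the inner curvature operators. Repeating a pair is useful only if the
    repeated pairs contribute in a controlled way. Three configurations have this property. If X and
    Y are eigenvectors of R(X, Y), the pairs only add to a total weight. If R(X, Y) exchanges X and
    Y up to factors, a pair hit by it becomes (X, X) or (Y, Y), which antisymmetry kills. If the
    operator of the repeated pair is zero, the outermost operator must hit the first of these pairs,
    or nothing survives. In each case the pairs are removed one by one until a component of omega,
    or of R omega, is left, so the order of vanishing never matters.

    Dimension 4 enters because proving omega(u, e) = 0 in an orthogonal frame uses the two remaining
    vectors. The signature enters through the complement of a hyperbolic plane: it is positive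
    definite, so the part of S acting there can be diagonalized even when S itself cannot. *)

Definition upd s i v : nat -> V := fun j => if j == i then v else s j.

Definition cons2 (X Y : V) s : nat -> V :=
  fun i => match i with 0 => X | 1 => Y | i'.+2 => s i' end.

(** Arguments are sequences indexed by all of [nat], so that tensors of every order share one type;
    pair number [j] occupies the slots [j.*2] and [j.*2.+1]. *)
Definition swp j s : nat -> V := fun i =>
  if i == j.*2 then s j.*2.+1 else if i == j.*2.+1 then s j.*2 else s i.

Lemma cons2_eta s : s = cons2 (s 0) (s 1) (fun i => s i.+2).
Proof. by apply: funext => -[|[|i]]. Qed.

Lemma upd_cons2_0 X Y s v : upd (cons2 X Y s) 0 v = cons2 v Y s.
Proof. by apply: funext => -[|[|i]]. Qed.

Lemma upd_cons2_1 X Y s v : upd (cons2 X Y s) 1 v = cons2 X v s.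
Proof. by apply: funext => -[|[|i]]. Qed.

Lemma upd_cons2_SS X Y s i v :
  upd (cons2 X Y s) i.+2 v = cons2 X Y (upd s i v).
Proof. by apply: funext => -[|[|j]]. Qed.

Lemma upd_iter_cons2 j X Y s i v :
  upd (iter j (cons2 X Y) s) (j.*2 + i) v = iter j (cons2 X Y) (upd s i v).
Proof. by elim: j => [|j IH] //; rewrite !iterS -IH -upd_cons2_SS. Qed.

Lemma upd_id s i : upd s i (s i) = s.
Proof. by apply: funext => j; rewrite /upd; case: eqP => [->|]. Qed.

Lemma upd_upd s i v w : upd (upd s i v) i w = upd s i w.
Proof. by apply: funext => j; rewrite /upd; case: eqP. Qed.

Lemma updC s i j v w : i != j -> upd (upd s i v) j w = upd (upd s j w) i v.
Proof.
move=> /eqP ij; apply: funext => k; rewrite /upd.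
by case: eqP => [->|//]; case: eqP => // e; case: ij; rewrite e.
Qed.

Lemma upd_eq s i v : upd s i v i = v.
Proof. by rewrite /upd eqxx. Qed.

Lemma upd_neq s i j v : j != i -> upd s i v j = s j.
Proof. by rewrite /upd => /negbTE ->. Qed.

Lemma swp_cons2_0 X Y s : swp 0 (cons2 X Y s) = cons2 Y X s.
Proof. by apply: funext => -[|[|i]]. Qed.

Lemma swp_cons2_S j X Y s : swp j.+1 (cons2 X Y s) = cons2 X Y (swp j s).
Proof. by apply: funext => -[|[|i]]. Qed.

Lemma swp_iter_cons2 j X Y Z s :
  swp j (iter j (cons2 X Y) (cons2 Z Z s)) = iter j (cons2 X Y) (cons2 Z Z s).
Proof. by elim: j => [|j IH] /=; rewrite ?swp_cons2_0 ?swp_cons2_S ?IH. Qed.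

End Slots.

Section Action.
Variables (V : Type) (K : nmodType).
Implicit Types (A : V -> V) (f : (nat -> V) -> K) (s : nat -> V).

(** The derivation induced by [A] on covariant tensors, without its minus sign, which is added at
    each use. *)
Definition dact A p f s : K := \sum_(i < p) f (upd s i (A (s i))).

Lemma dact_cons2 A p f X Y s :
  dact A p.+2 f (cons2 X Y s) =
  f (cons2 (A X) Y s) + f (cons2 X (A Y) s) + dact A p (f \o cons2 X Y) s.
Proof.
rewrite /dact !big_ord_recl /= addrA upd_cons2_0 upd_cons2_1.
by congr (_ + _); apply: eq_bigr => i _; rewrite upd_cons2_SS.
Qed.

(** Exchanging the entries of a pair permutes the summands by a transposition, provided both slots
    are among the first [p]. *)
Lemma dact_swp A p f j s : (j.*2.+1 < p)%N ->
  dact A p f (swp j s) = dact A p (f \o swp j) s.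
Proof.
move=> jp; have jp' : (j.*2 < p)%N by apply: ltnW.
rewrite /dact (reindex_inj (perm_inj (s := tperm (Ordinal jp') (Ordinal jp)))).
apply: eq_bigr => i _ /=; congr f; apply: funext => k.
have n01 : (j.*2 == j.*2.+1) = false by apply/eqP; lia.
have n10 : (j.*2.+1 == j.*2) = false by apply/eqP; lia.
rewrite /upd /swp; case: tpermP => [->|->|/eqP i0 /eqP i1] /=.
- rewrite !eqxx ?n10; case: (eqVneq k j.*2.+1) => [->|_].
    by rewrite n10.
  by case: eqP.
- rewrite !eqxx ?n01; case: (eqVneq k j.*2) => [//|_].
  by case: eqP.
- have /negbTE i0' : nat_of_ord i != j.*2 by [].
  have /negbTE i1' : nat_of_ord i != j.*2.+1 by [].
  rewrite i0' i1' ![_ == nat_of_ord i]eq_sym i0' i1'.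
  by case: (eqVneq k i) => [->|_] //; rewrite i0' i1'.
Qed.

End Action.

Section CurvatureTensor.
Variables (K : comNzRingType) (n : nat).
Implicit Types (A B h S w : 'M[K]_n) (X Y Z v : 'rV[K]_n) (s : nat -> 'rV[K]_n).

Definition mxform A v v' : K := (v *m A *m v'^T) 0 0.

Lemma mxform_linl A a v v' u :
  mxform A (a *: v + v') u = a * mxform A v u + mxform A v' u.
Proof. by rewrite /mxform !mulmxDl -!scalemxAl !mxE. Qed.

Lemma mxform_linr A a v v' u :
  mxform A u (a *: v + v') = a * mxform A u v + mxform A u v'.
Proof. by rewrite /mxform linearD linearZ /= mulmxDr -scalemxAr !mxE. Qed.

Lemma mxformDl A u u' v : mxform A (u + u') v = mxform A u v + mxform A u' v.
Proof. by rewrite -{1}(scale1r u) mxform_linl mul1r. Qed.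
Lemma mxformDr A u u' v : mxform A v (u + u') = mxform A v u + mxform A v u'.
Proof. by rewrite -{1}(scale1r u) mxform_linr mul1r. Qed.
Lemma mxform0l A v : mxform A 0 v = 0.
Proof. by rewrite /mxform !mul0mx mxE. Qed.
Lemma mxform0r A v : mxform A v 0 = 0.
Proof. by rewrite /mxform trmx0 mulmx0 mxE. Qed.
Lemma mxformZl A a u v : mxform A (a *: u) v = a * mxform A u v.
Proof. by rewrite -[X in mxform _ X _]addr0 mxform_linl mxform0l addr0. Qed.
Lemma mxformZr A a u v : mxform A v (a *: u) = a * mxform A v u.
Proof. by rewrite -[X in mxform _ _ X]addr0 mxform_linr mxform0r addr0. Qed.
Lemma mxformNl A u v : mxform A (- u) v = - mxform A u v.
Proof. by rewrite -scaleN1r mxformZl mulN1r. Qed.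
Lemma mxformNr A u v : mxform A v (- u) = - mxform A v u.
Proof. by rewrite -scaleN1r mxformZr mulN1r. Qed.

Definition mxformE := (mxformDl, mxformDr, mxformZl, mxformZr, mxformNl, mxformNr,
  mxform0l, mxform0r).

Lemma mxform_delta A i j : mxform A (delta_mx 0 i) (delta_mx 0 j) = A i j.
Proof. by rewrite /mxform -rowE trmx_delta -colE !mxE. Qed.

(* R(X, Y)Z according to the Gauss equation *)
Definition gauss h S X Y Z : 'rV[K]_n :=
  mxform h Y Z *: (X *m S) - mxform h X Z *: (Y *m S).

Lemma gauss_anti h S X Y Z : gauss h S Y X Z = - gauss h S X Y Z.
Proof. by rewrite /gauss opprB. Qed.

Lemma gauss_linl h S a X X' Y Z :
  gauss h S (a *: X + X') Y Z = a *: gauss h S X Y Z + gauss h S X' Y Z.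
Proof.
rewrite /gauss mxform_linl mulmxDl -scalemxAl scalerDr scalerDl scalerBr.
by rewrite !scalerA mulrC opprD addrACA.
Qed.

Lemma gauss_linm h S a X X' Y Z :
  gauss h S Y (a *: X + X') Z = a *: gauss h S Y X Z + gauss h S Y X' Z.
Proof. by rewrite gauss_anti gauss_linl opprD -scalerN -!gauss_anti. Qed.

Lemma gauss_linr h S a X Y Z Z' :
  gauss h S X Y (a *: Z + Z') = a *: gauss h S X Y Z + gauss h S X Y Z'.
Proof.
rewrite /gauss !mxform_linr !scalerDl -!scalerA scalerBr opprD.
by rewrite addrACA.
Qed.

(* curv h S w m is R^m . w, where R acts as a derivation on all the slots; the
   slots beyond the (2m+2)-th one are ignored. *)
Fixpoint curv h S w m : (nat -> 'rV[K]_n) -> K :=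
  if m is m'.+1 then fun s =>
    - dact (gauss h S (s 0) (s 1)) m'.+1.*2 (curv h S w m') (fun i => s i.+2)
  else fun s => mxform w (s 0) (s 1).

Lemma curvS h S w m s :
  curv h S w m.+1 s =
  - dact (gauss h S (s 0) (s 1)) m.+1.*2 (curv h S w m) (fun i => s i.+2).
Proof. by []. Qed.

Lemma curv_cons2 h S w m X Y s :
  curv h S w m.+1 (cons2 X Y s) =
  - dact (gauss h S X Y) m.+1.*2 (curv h S w m) s.
Proof. by []. Qed.

Lemma curv0 h S w X Y s : curv h S w 0 (cons2 X Y s) = mxform w X Y.
Proof. by []. Qed.

Section Multilinear.
Variables h S w : 'M[K]_n.
Local Notation T := (curv h S w).
Local Notation rho := (gauss h S).

(** The slots of the outermost pair are linear through [gauss]. A later slot is linear by induction,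
    except in the summand where the operator hits this very slot; there the linearity of the
    operator is used as well. *)
Lemma curv_lin m s i a v v' : (i < m.+1.*2)%N ->
  T m (upd s i (a *: v + v')) = a * T m (upd s i v) + T m (upd s i v').
Proof.
elim: m s i v v' => [|m IH] s i v v' im.
  by case: i im => [|[|i]] // _; rewrite /= ?mxform_linl ?mxform_linr.
rewrite (cons2_eta s); move: (s 0) (s 1) (fun i => s i.+2) => X Y {}s.
case: i im => [|[|i]] im; rewrite ?upd_cons2_0 ?upd_cons2_1 ?upd_cons2_SS.
- rewrite !curv_cons2 /dact -!sumrN mulr_sumr -big_split; apply: eq_bigr => j _.
  by rewrite /= gauss_linl IH // opprD mulrN.
- rewrite !curv_cons2 /dact -!sumrN mulr_sumr -big_split; apply: eq_bigr => j _.
  by rewrite /= gauss_linm IH // opprD mulrN.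
- have im' : (i < m.+1.*2)%N by move: im; rewrite doubleS !ltnS.
  rewrite !curv_cons2 /dact -!sumrN mulr_sumr -big_split; apply: eq_bigr => j _ /=.
  case: (eqVneq (nat_of_ord j) i) => [->|ji].
    by rewrite !upd_upd !upd_eq gauss_linr IH // opprD mulrN.
  rewrite !upd_neq // !(@updC _ _ i) 1?eq_sym // IH // opprD mulrN.
  by [].
Qed.

Lemma curv_upd0 m s i : (i < m.+1.*2)%N -> T m (upd s i 0) = 0.
Proof.
by move=> im; have := @curv_lin m s i (-1) 0 0 im; rewrite addr0 scaler0 mulN1r addNr.
Qed.

Lemma curv_scale m s i a v : (i < m.+1.*2)%N ->
  T m (upd s i (a *: v)) = a * T m (upd s i v).
Proof.
by move=> im; rewrite -[X in upd _ _ X]addr0 curv_lin // curv_upd0 // addr0.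
Qed.

(** The outermost pair is skew because [gauss] is, and the swap of a later pair passes through the
    derivation. The bound [j < m] leaves out the last pair, the arguments of the arbitrary form
    [w]. *)
Lemma curv_swp m j s : (j < m)%N -> T m (swp j s) = - T m s.
Proof.
elim: m j s => // m IH j s jm.
rewrite (cons2_eta s); move: (s 0) (s 1) (fun i => s i.+2) => X Y {}s.
case: j jm => [|j] jm.
  rewrite swp_cons2_0 !curv_cons2 opprK /dact -sumrN; apply: eq_bigr => i _.
  by rewrite gauss_anti -[- gauss _ _ _ _ _]scaleN1r curv_scale // mulN1r opprK.
rewrite swp_cons2_S !curv_cons2 dact_swp; last by rewrite -!muln2; lia.
by rewrite /dact -!sumrN; apply: eq_bigr => i _ /=; rewrite IH.
Qed.

Lemma curv_vanish m r : (forall s, T m s = 0) -> forall s, T (r + m) s = 0.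
Proof.
move=> T0; elim: r => // r IH s.
by rewrite addSn /= /dact big1 ?oppr0 // => i _; rewrite IH.
Qed.

End Multilinear.
End CurvatureTensor.
Arguments curv : simpl never.

Section Evaluation.
Variables (R : realFieldType) (n : nat) (h S w : 'M[R]_n).
Implicit Types (X Y Z v : 'rV[R]_n) (s : nat -> 'rV[R]_n).
Local Notation T := (curv h S w).
Local Notation rho := (gauss h S).

Lemma curv_scale0 m X Y s a : T m (cons2 (a *: X) Y s) = a * T m (cons2 X Y s).
Proof. by rewrite -(upd_cons2_0 X Y s (a *: X)) curv_scale // upd_cons2_0. Qed.

Lemma curv_scale1 m X Y s a : T m (cons2 X (a *: Y) s) = a * T m (cons2 X Y s).
Proof. by rewrite -(upd_cons2_1 X Y s (a *: Y)) curv_scale // upd_cons2_1. Qed.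

Lemma dact_eigen (A : 'rV[R]_n -> 'rV[R]_n) m s (c : nat -> R) p :
  (p <= m.+1.*2)%N -> (forall i, (i < p)%N -> A (s i) = c i *: s i) ->
  dact A p (T m) s = (\sum_(i < p) c i) * T m s.
Proof.
move=> pm As; rewrite /dact mulr_suml; apply: eq_bigr => i _.
by rewrite As // curv_scale ?upd_id //; apply: leq_trans pm.
Qed.

(* When X, Y are eigenvectors of the operator rho(X, Y), and so are all the
   vectors of s, every application of this operator multiplies by minus the
   total weight. *)
Lemma curv_eigen l r X Y s a b (c : nat -> R) :
  (forall s, T l s = 0) ->
  rho X Y X = a *: X -> rho X Y Y = b *: Y ->
  (forall i, (i < r.+1.*2)%N -> rho X Y (s i) = c i *: s i) ->
  (forall j, j%:R * (a + b) + \sum_(i < r.+1.*2) c i != 0) ->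
  T r s = 0.
Proof.
move=> T0 eX eY es c0.
have {T0} : T (l + r) (iter l (cons2 X Y) s) = 0.
  by rewrite addnC; apply: curv_vanish.
(* Up to sign, the value on [l.+1] copies of the pair is the total weight times the value on [l]
   copies, so non-zero weights allow the copies to be removed one at a time. *)
elim: l => // l IH; rewrite addSn iterS curv_cons2 => /eqP; rewrite oppr_eq0.
suff -> : dact (rho X Y) (l + r).+1.*2 (T (l + r)) (iter l (cons2 X Y) s) =
   (l%:R * (a + b) + \sum_(i < r.+1.*2) c i) * T (l + r) (iter l (cons2 X Y) s).
  by rewrite mulf_eq0 (negbTE (c0 _)) => /eqP.
pose d := iter l (cons2 a b) c.
have ed i : (i < (l + r).+1.*2)%N ->
    rho X Y (iter l (cons2 X Y) s i) = d i *: iter l (cons2 X Y) s i.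
  rewrite /d; elim: (l) i => [|k IHk] [|[|i]] //= ik; try exact: es.
  by apply: IHk; lia.
rewrite (dact_eigen _ ed) //; congr (_ * _).
rewrite /d; elim: (l) => [|k IHk]; first by rewrite mul0r add0r.
rewrite addSn (doubleS (k + r).+1) big_ord_recl big_ord_recl.
rewrite (eq_bigr (fun i : 'I_(k + r).+1.*2 => iter k (cons2 a b) c i)) // IHk.
by rewrite -natr1 /=; ring.
Qed.

Lemma curv_pair_eq m j X Y Z s : (j < m)%N ->
  T m (iter j (cons2 X Y) (cons2 Z Z s)) = 0.
Proof.
move=> /(curv_swp h S w (iter j (cons2 X Y) (cons2 Z Z s))).
by rewrite swp_iter_cons2 => /eqP; rewrite eq_sym eqNr => /eqP.
Qed.

(* The pairs (X, Y) do not contribute, since rho(X, Y) maps them to multiples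
   of (Y, Y) and (X, X). *)
Lemma curv_plane m X Y s a b :
  rho X Y X = a *: Y -> rho X Y Y = b *: X ->
  T m.+1 (iter m.+1 (cons2 X Y) s) =
  - dact (rho X Y) 2 (T m \o iter m (cons2 X Y)) s.
Proof.
move=> eX eY; rewrite iterS curv_cons2; congr (- _).
suff H k j : (j + k = m)%N ->
    dact (rho X Y) k.+1.*2 (T m \o iter j (cons2 X Y)) (iter k (cons2 X Y) s) =
    dact (rho X Y) 2 (T m \o iter m (cons2 X Y)) s.
  by rewrite -(H m 0%N).
elim: k j => [|k IH] j jk; first by rewrite -jk addn0.
rewrite doubleS iterS dact_cons2 /= eX eY.
have jm : (j < m)%N by lia.
have jm0 : (j.*2 + 0 < m.+1.*2)%N by lia.
have jm1 : (j.*2 + 1 < m.+1.*2)%N by lia.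
rewrite -(upd_cons2_0 Y Y _ (a *: Y)) -(upd_cons2_1 X X _ (b *: X)) -!upd_iter_cons2.
rewrite !curv_scale //.
rewrite !upd_iter_cons2 upd_cons2_0 upd_cons2_1 !curv_pair_eq // !mulr0.
rewrite addr0 add0r -(IH j.+1); last by lia.
by congr dact; apply: funext => t /=; rewrite -iterS iterSr.
Qed.

(** By [curv_plane] the operator acts only on the last two arguments, where it exchanges [X] and [Y]
    up to factors and kills [v]. Removing a pair thus turns the value at (X, v) into the one at (Y,
    v) and conversely, so both are carried through the induction. *)
Lemma plane_orth l X Y v a b : (forall s, T l s = 0) ->
  rho X Y X = a *: Y -> rho X Y Y = b *: X -> rho X Y v = 0 ->
  a != 0 -> b != 0 -> mxform w X v = 0 /\ mxform w Y v = 0.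
Proof.
move=> + eX eY ev; pose s := (fun _ : nat => v).
suff H : a != 0 -> b != 0 -> forall m, T m (iter m (cons2 X Y) (cons2 X v s)) = 0 ->
    T m (iter m (cons2 X Y) (cons2 Y v s)) = 0 ->
    mxform w X v = 0 /\ mxform w Y v = 0.
  by move=> T0 a0 b0; apply: (H a0 b0 l); apply: T0.
move=> a0 b0; elim=> [|m IH]; first by rewrite /= !curv0.
rewrite !(curv_plane _ _ eX eY) !dact_cons2 /= /dact !big_ord0 eX eY ev !addr0.
have c01 Z : T m (iter m (cons2 X Y) (cons2 Z 0 s)) = 0.
  by rewrite -(upd_cons2_1 Z Z s 0) -upd_iter_cons2 curv_upd0 //; lia.
have c0 c Z : T m (iter m (cons2 X Y) (cons2 (c *: Z) v s)) =
    c * T m (iter m (cons2 X Y) (cons2 Z v s)).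
  rewrite -(upd_cons2_0 Z v s (c *: Z)) -upd_iter_cons2 curv_scale; last by lia.
  by rewrite upd_iter_cons2 upd_cons2_0.
rewrite !c01 !c0 !addr0 => /eqP; rewrite oppr_eq0 mulf_eq0 (negbTE a0) => /eqP TY.
by move/eqP; rewrite oppr_eq0 mulf_eq0 (negbTE b0) => /eqP TX; apply: IH.
Qed.

(* Since rho(f, g) = 0, only the first of the pairs (f, g) contributes: rho(u, f)
   turns it into a multiple of (u, g) and rho(u, g) into a multiple of (f, u), so
   that f and g exchange their roles each time a pair is removed. *)
Lemma curv_turn u f g e s d p q m :
  u *m S = d *: u -> f *m S = 0 -> g *m S = 0 ->
  mxform h f f = p -> mxform h g g = q ->
  [/\ mxform h f g = 0, mxform h g f = 0, mxform h f u = 0 & mxform h g u = 0] ->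
  mxform h f e = 0 -> mxform h g e = 0 -> d != 0 -> p != 0 -> q != 0 ->
  ((forall z, T m.+1 (cons2 u f (iter m (cons2 f g) (cons2 z e s))) = 0) ->
    mxform w u e = 0) /\
  ((forall z, T m.+1 (cons2 u g (iter m (cons2 f g) (cons2 z e s))) = 0) ->
    mxform w u e = 0).
Proof.
move=> uS fS gS ff gg [fg gf fu gu] fe ge d0 p0 q0.
have rfg v : rho f g v = 0 by rewrite /gauss fS gS !scaler0 subrr.
have rf v : rho u f v = (mxform h f v * d) *: u.
  by rewrite /gauss fS uS scaler0 subr0 scalerA.
have rg v : rho u g v = (mxform h g v * d) *: u.
  by rewrite /gauss gS uS scaler0 subr0 scalerA.
have c00 k Y t : T k (cons2 0 Y t) = 0.
  by rewrite -(scale0r 0) curv_scale0 mul0r.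
have c01 k Y t : T k (cons2 Y 0 t) = 0.
  by rewrite -(scale0r 0) curv_scale1 mul0r.
have cfg k t : T k.+1 (cons2 f g t) = 0.
  rewrite curv_cons2 /dact big1 ?oppr0 // => i _.
  by rewrite rfg curv_upd0.
have acfg (A : 'rV[R]_n -> 'rV[R]_n) i k t : dact A i (T k.+1 \o cons2 f g) t = 0.
  by rewrite /dact big1 // => j _ /=.
elim: m => [|m [IHf IHg]]; split=> T0.
(* [z] has stayed free during the descent. Here it is chosen so that the operator sends it to a
   non-zero multiple of [u]: [f] for rho(u, f), and [g] for rho(u, g) below. *)
- have := T0 f; rewrite /= curv_cons2 dact_cons2 /dact big_ord0 !curv0 !rf.
  rewrite ff fe mul0r !scale0r !mxformE addr0 addr0 => /eqP.
  by rewrite oppr_eq0 !mulf_eq0 (negbTE d0) (negbTE p0) => /eqP.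
- have := T0 g; rewrite /= curv_cons2 dact_cons2 /dact big_ord0 !curv0 !rg.
  rewrite gg ge mul0r !scale0r !mxformE addr0 addr0 => /eqP.
  by rewrite oppr_eq0 !mulf_eq0 (negbTE d0) (negbTE q0) => /eqP.
- apply: IHg => z; have := T0 z.
  rewrite curv_cons2 iterS doubleS dact_cons2 acfg !rf ff fg mul0r scale0r c01 !addr0.
  by rewrite curv_scale0 => /eqP; rewrite oppr_eq0 !mulf_eq0 (negbTE d0) (negbTE p0) => /eqP.
- apply: IHf => z; have := T0 z.
  rewrite curv_cons2 iterS doubleS dact_cons2 acfg !rg gg gf mul0r scale0r c00 !addr0 add0r.
  rewrite curv_scale1 => /eqP; rewrite oppr_eq0 !mulf_eq0 (negbTE d0) (negbTE q0) /= => /eqP.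
  have := curv_swp h S w (cons2 u f (iter m (cons2 f g) (cons2 z e s))) (isT : (0 < m.+1)%N).
  by rewrite swp_cons2_0 => -> /eqP; rewrite oppr_eq0 => /eqP.
Qed.

End Evaluation.

(** * Degenerations and diagonalizable shape operators *)

Section Naturality.

Lemma mxform_mul (K : comNzRingType) n (P A : 'M[K]_n) X Y :
  mxform (P *m A *m P^T) X Y = mxform A (X *m P) (Y *m P).
Proof. by rewrite /mxform trmx_mul !mulmxA. Qed.

(** [P] carries the curvature operators of the pulled back data to those of [h] and [S], and need
    not be invertible. This serves for changes of frame, rescalings and isometries alike. *)
Lemma curv_intertwine (K : comNzRingType) n (P h S S' w : 'M[K]_n) m s :
  S' *m P = P *m S ->
  curv (P *m h *m P^T) S' (P *m w *m P^T) m s =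
  curv h S w m (fun i => s i *m P).
Proof.
move=> SP; elim: m s => [|m IH] s; first exact: mxform_mul.
rewrite !curvS; congr (- _); apply: eq_bigr => i _; rewrite IH; congr curv.
apply: funext => j; rewrite /upd; case: eqP => // _.
by rewrite /gauss mulmxBl -!scalemxAl !mxform_mul -!mulmxA SP !mulmxA.
Qed.

Lemma curv_scale_forms (K : comNzRingType) n (h S w : 'M[K]_n) a b m s :
  curv (a *: h) S (b *: w) m s = a ^+ m * b * curv h S w m s.
Proof.
have fZ A c X Y : mxform (c *: A) X Y = c * mxform A X Y :> K.
  by rewrite /mxform -scalemxAr -scalemxAl !mxE.
elim: m s => [|m IH] s; first by rewrite expr0 mul1r /curv fZ.
rewrite !curvS mulrN /dact mulr_sumr; congr (- _); apply: eq_bigr => i _.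
rewrite /gauss !fZ -!scalerA -scalerBr IH curv_scale //.
by rewrite exprS; ring.
Qed.

Lemma curvB (K : comNzRingType) n (h S w w' : 'M[K]_n) m s :
  curv h S (w - w') m s = curv h S w m s - curv h S w' m s.
Proof.
elim: m s => [|m IH] s.
  by rewrite /curv /mxform mulmxBr mulmxBl !mxE.
rewrite !curvS -opprD /dact -sumrB; congr (- _).
by apply: eq_bigr => i _; rewrite IH.
Qed.

Lemma curv_map (K K' : comNzRingType) (f : {rmorphism K -> K'}) n
    (h S w : 'M[K]_n) m s :
  f (curv h S w m s) =
  curv (map_mx f h) (map_mx f S) (map_mx f w) m (fun i => map_mx f (s i)).
Proof.
have fm A X Y : f (mxform A X Y) = mxform (map_mx f A) (map_mx f X) (map_mx f Y).
  by rewrite /mxform map_trmx -!map_mxM [RHS]mxE.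
elim: m s => [|m IH] s; first exact: fm.
rewrite !curvS rmorphN rmorph_sum; congr (- _); apply: eq_bigr => i _.
rewrite IH; congr curv; apply: funext => j; rewrite /upd; case: eqP => // _.
by rewrite /gauss map_mxB !map_mxZ !map_mxM !fm.
Qed.

End Naturality.

Section Limit.
Variables (R : realFieldType).

Lemma poly_eq0_horner (q : {poly R}) :
  (forall t, t != 0 -> q.[t] = 0) -> q = 0.
Proof.
move=> q0; apply/eqP; apply: contraT => qn0.
(* The points 1, 2, ..., [size q] are distinct and non-zero in characteristic 0, and too many to be
   roots of a non-zero [q]. *)
pose rs := [seq i.+1%:R : R | i <- iota 0 (size q)].
have : (size rs < size q)%N.
  apply: max_poly_roots => //.
    by apply/allP => _ /mapP[i _ ->]; apply/rootP; rewrite q0 // pnatr_eq0.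
  rewrite map_inj_uniq ?iota_uniq // => i j /eqP.
  by rewrite eqr_nat => /eqP[].
by rewrite size_map size_iota ltnn.
Qed.

(* The pair of leading parts is the limit of the rescaled transforms of (S, w) by
   diag(t^wt), a similarity of h, as t tends to 0; the vanishing of curv passes to
   it because curv is polynomial in t. *)
Lemma curv_leading n (h S w : 'M[R]_n) (wt : 'I_n -> nat) p c l :
  (forall i j, h i j != 0 -> (wt i + wt j)%N = p) ->
  (forall i j, S i j != 0 -> (wt i <= wt j)%N) ->
  (forall i j, w i j != 0 -> (wt i + wt j <= c)%N) ->
  (forall s, curv h S w l s = 0) ->
  forall s, curv h (\matrix_(i, j) if wt i == wt j then S i j else 0)
    (\matrix_(i, j) if (wt i + wt j == c)%N then w i j else 0) l s = 0.
Proof.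
move=> hp Sle wle T0 s.
(* The truncated subtractions in the exponents are harmless: where one would be negative, the
   coefficient is zero by [Sle] or [wle]. *)
pose ST : 'M[{poly R}]_n := \matrix_(i, j) ((S i j)%:P * 'X^(wt j - wt i)).
pose wT : 'M[{poly R}]_n := \matrix_(i, j) ((w i j)%:P * 'X^(c - (wt i + wt j))).
pose hT := map_mx polyC h.
pose q := curv hT ST wT l (fun i => map_mx polyC (s i)).
have qE t : q.[t] = curv h (\matrix_(i, j) (S i j * t ^+ (wt j - wt i)))
    (\matrix_(i, j) (w i j * t ^+ (c - (wt i + wt j)))) l s.
  rewrite -/(horner_eval t q) curv_map; congr (curv _ _ _ l).
  - by apply/matrixP => i j; rewrite !mxE /= horner_evalE hornerC.
  - by apply/matrixP => i j; rewrite !mxE /= horner_evalE !hornerE.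
  - by apply/matrixP => i j; rewrite !mxE /= horner_evalE !hornerE.
  - by apply: funext => k; apply/rowP => j; rewrite !mxE /= horner_evalE hornerC.
suff /poly_eq0_horner q0 : forall t, t != 0 -> q.[t] = 0.
  (* At 0 the powers with exponent 0 are 1 and all others vanish, which leaves exactly the leading
     parts. *)
  have := qE 0; rewrite q0 horner0 => /esym; apply: etrans.
  congr (curv _ _ _ l s).
    apply/matrixP => i j; rewrite !mxE; case: eqP => [->|e].
      by rewrite subnn expr0 mulr1.
    have [->|/Sle le] := eqVneq (S i j) 0; first by rewrite mul0r.
    by rewrite expr0n subn_eq0 leqNgt ltn_neqAle le andbT; move/eqP: e => ->; rewrite mulr0.
  apply/matrixP => i j; rewrite !mxE; case: eqP => [->|e].
    by rewrite subnn expr0 mulr1.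
  have [->|/wle le] := eqVneq (w i j) 0; first by rewrite mul0r.
  by rewrite expr0n subn_eq0 leqNgt ltn_neqAle le andbT; move/eqP: e => ->; rewrite mulr0.
move=> t t0; rewrite qE.
(* [D] conjugates the rescaled operator to [S], multiplies [h] by t^p and turns the rescaled form
   into t^c times [w], so the value is a multiple of one of [curv h S w l]. *)
pose D : 'M[R]_n := diag_mx (\row_i t ^+ wt i).
pose D' : 'M[R]_n := diag_mx (\row_i t ^- wt i).
have DD : D' *m D = 1%:M.
  rewrite mulmx_diag -diag_const_mx; congr diag_mx; apply/rowP => i; rewrite !mxE.
  by rewrite mulVf // expf_neq0.
have -> : s = (fun i => (s i *m D') *m D).
  by apply: funext => i; rewrite -mulmxA DD mulmx1.
rewrite -(@curv_intertwine _ _ D h _ S); last first.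
  apply/matrixP => i j; rewrite mul_mx_diag mul_diag_mx !mxE.
  have [->|/Sle le] := eqVneq (S i j) 0; first by rewrite !(mul0r, mulr0).
  by rewrite mulrCA -exprD subnKC // mulrC.
have -> : D *m h *m D^T = t ^+ p *: h.
  rewrite tr_diag_mx; apply/matrixP => i j; rewrite mul_mx_diag mul_diag_mx !mxE.
  have [->|/hp <-] := eqVneq (h i j) 0; first by rewrite !(mul0r, mulr0).
  by rewrite exprD; ring.
set wt' := \matrix_(_, _) _.
have -> : D *m wt' *m D^T = t ^+ c *: w.
  rewrite tr_diag_mx; apply/matrixP => i j; rewrite mul_mx_diag mul_diag_mx !mxE.
  have [->|/wle le] := eqVneq (w i j) 0; first by rewrite !(mul0r, mulr0).
  by rewrite -{2}(subnK le) !exprD; ring.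
by rewrite curv_scale_forms T0 mulr0.
Qed.

End Limit.

Section Diagonal.
Variables (R : realFieldType) (n : nat) (h S w : 'M[R]_n) (l : nat).
Hypothesis h_sym : forall X Y, mxform h X Y = mxform h Y X.
Hypothesis T0 : forall s, curv h S w l s = 0.

(** If [f] or [g] has a non-zero eigenvalue, its curvature operator with [u] exchanges the two
    vectors up to non-zero factors and kills [e], so [plane_orth] applies. If both lie in the kernel
    of [S], [curv_turn] takes over. *)
Lemma diag_orth u e f g du df dg :
  u *m S = du *: u -> f *m S = df *: f -> g *m S = dg *: g ->
  mxform h u u != 0 -> mxform h f f != 0 -> mxform h g g != 0 ->
  mxform h u f = 0 -> mxform h u g = 0 -> mxform h f g = 0 ->
  mxform h u e = 0 -> mxform h f e = 0 -> mxform h g e = 0 ->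
  du != 0 -> mxform w u e = 0.
Proof.
move=> uS fS gS uu ff gg uf ug fg ue fe ge du0.
have pl f' d' : f' *m S = d' *: f' -> mxform h f' f' != 0 -> mxform h u f' = 0 ->
    mxform h f' e = 0 -> d' != 0 -> mxform w u e = 0.
  move=> f'S f'f' uf' f'e d'0.
  apply: (proj1 (@plane_orth _ _ h S w l u f' e (- (mxform h u u * d'))
    (mxform h f' f' * du) T0 _ _ _ _ _)).
  - by rewrite /gauss (h_sym f') uf' scale0r sub0r f'S scalerA scaleNr.
  - by rewrite /gauss uf' scale0r subr0 uS scalerA.
  - by rewrite /gauss f'e ue !scale0r subrr.
  - by rewrite oppr_eq0 mulf_neq0.
  - by rewrite mulf_neq0.
have [df0|df0] := eqVneq df 0; last exact: (pl f df).
have [dg0|dg0] := eqVneq dg 0; last exact: (pl g dg).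
rewrite df0 scale0r in fS; rewrite dg0 scale0r in gS.
have := @curv_turn _ _ h S w u f g e (fun=> 0) du _ _ l uS fS gS erefl erefl.
case=> //; first by split=> //; rewrite h_sym.
by move=> + _; apply => z; have := curv_vanish 1 T0; rewrite add1n.
Qed.

Section NullFrame.
Variables (a b f g : 'rV[R]_n) (d df dg : R).
Hypotheses (aS : a *m S = d *: a) (bS : b *m S = d *: b)
  (fS : f *m S = df *: f) (gS : g *m S = dg *: g)
  (aa : mxform h a a = 0) (bb : mxform h b b = 0) (ab : mxform h a b != 0)
  (ff : mxform h f f != 0) (gg : mxform h g g != 0) (fg : mxform h f g = 0)
  (af : mxform h a f = 0) (bf : mxform h b f = 0)
  (ag : mxform h a g = 0) (bg : mxform h b g = 0).

(** The null vectors [a] and [b] share an eigenvalue, so a + b and a - b are eigenvectors too; being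
    orthogonal and non-null, they make [diag_orth] available. *)
Let orthDB : [/\ mxform h (a + b) (a + b) != 0, mxform h (a - b) (a - b) != 0,
  mxform h (a + b) (a - b) = 0,
  mxform h (a + b) f = 0 /\ mxform h (a - b) f = 0 &
  mxform h (a + b) g = 0 /\ mxform h (a - b) g = 0].
Proof.
rewrite !mxformE aa bb (h_sym b a) af bf ag bg !(add0r, addr0, subr0, sub0r, opprK, oppr0).
rewrite -mulr2n -opprD -mulr2n oppr_eq0 mulrn_eq0 /= addrC subrr.
by split.
Qed.

Lemma null_frame_orth : d != 0 ->
  [/\ mxform w a f = 0, mxform w a g = 0 &
      (mxform w b a = - mxform w a b) -> mxform w a a = 0 ->
      mxform w b b = 0 -> mxform w a b = 0].
Proof.
move=> d0; case: orthDB => pp mm pm [pf mf] [pg mg].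
have pS : (a + b) *m S = d *: (a + b) by rewrite mulmxDl aS bS scalerDr.
have mS : (a - b) *m S = d *: (a - b) by rewrite mulmxBl aS bS scalerBr.
have sw := fun X Y e => etrans (h_sym X Y) e.
have gf : mxform h g f = 0 by rewrite h_sym.
have E1 : mxform w (a + b) f = 0 by apply: (diag_orth pS mS gS) => //; apply: sw.
have E2 : mxform w (a - b) f = 0 by apply: (diag_orth mS pS gS) => //; apply: sw.
have E3 : mxform w (a + b) g = 0 by apply: (diag_orth pS mS fS) => //; apply: sw.
have E4 : mxform w (a - b) g = 0 by apply: (diag_orth mS pS fS) => //; apply: sw.
have E5 : mxform w (a + b) (a - b) = 0.
  by apply: (diag_orth pS fS gS) => //; apply: sw.
move: E1 E2 E3 E4 E5; rewrite !mxformE => E1 E2 E3 E4 E5; split; [lra|lra|].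
by move=> ba waa wbb; move: E5; rewrite waa wbb ba; lra.
Qed.

Lemma space_orth : df != 0 ->
  [/\ mxform w f a = 0, mxform w f b = 0 & mxform w f g = 0].
Proof.
move=> df0; case: orthDB => pp mm pm [pf mf] [pg mg].
have pS : (a + b) *m S = d *: (a + b) by rewrite mulmxDl aS bS scalerDr.
have mS : (a - b) *m S = d *: (a - b) by rewrite mulmxBl aS bS scalerBr.
have sw := fun X Y e => etrans (h_sym X Y) e.
have gf : mxform h g f = 0 by rewrite h_sym.
have E1 : mxform w f (a + b) = 0 by apply: (diag_orth fS mS gS) => //; apply: sw.
have E2 : mxform w f (a - b) = 0 by apply: (diag_orth fS pS gS) => //; apply: sw.
have E3 : mxform w f g = 0 by apply: (diag_orth fS pS mS) => //; apply: sw.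
by move: E1 E2; rewrite !mxformE => E1 E2; split; [lra|lra|].
Qed.

End NullFrame.
End Diagonal.

(** * Self-adjoint operators in Lorentzian 4-space *)

Section Eigenvectors.
Variables (R : rcfType) (n : nat).

(* a + i b is an eigenvector of S for the eigenvalue la + i mu *)
Lemma complex_eigenvector m (W : 'M[R]_(m, n)) (S : 'M[R]_n) :
  W != 0 -> (W *m S <= W)%MS ->
  exists (a b : 'rV[R]_n) (la mu : R), [/\ a != 0 \/ b != 0, (a <= W)%MS, (b <= W)%MS,
    a *m S = la *: a - mu *: b & b *m S = mu *: a + la *: b].
Proof.
move=> W0 WS; set B := row_base W.
have BS : (B *m S <= B)%MS.
  by rewrite (eqmxMr S (eq_row_base W)) (eq_row_base W).
have [A AB] := submxP BS.
have r0 : (\rank W > 0)%N by rewrite lt0n mxrank_eq0.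
have [z /eigenvalueP[v vA v0]] := eigenvalue_closed (map_mx (real_complex R) A) r0.
pose re := map_mx (@complex.Re R) v; pose im := map_mx (@complex.Im R) v.
have reA j : (re *m A) 0 j = complex.Re z * re 0 j - complex.Im z * im 0 j.
  have := congr1 (fun u : 'rV[R[i]]_(\rank W) => complex.Re (u 0 j)) vA.
  rewrite !mxE raddf_sum /= => e.
  transitivity (complex.Re (z * v 0 j)); last by case: (z) (v 0 j) => ? ? [? ?].
  by rewrite -e; apply: eq_bigr => i _; rewrite !mxE; case: (v 0 i) => x y /=; ring.
have imA j : (im *m A) 0 j = complex.Im z * re 0 j + complex.Re z * im 0 j.
  have := congr1 (fun u : 'rV[R[i]]_(\rank W) => complex.Im (u 0 j)) vA.
  rewrite !mxE raddf_sum /= => e.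
  transitivity (complex.Im (z * v 0 j)); last first.
    by case: (z) (v 0 j) => ? ? [? ?] /=; ring.
  by rewrite -e; apply: eq_bigr => i _; rewrite !mxE; case: (v 0 i) => x y /=; ring.
have B0 (u : 'rV[R]_(\rank W)) : u *m B = 0 -> u = 0.
  by move=> u0; apply: (row_free_inj (row_base_free W)); rewrite mul0mx.
exists (re *m B), (im *m B), (complex.Re z), (complex.Im z); split.
- case: (eqVneq re 0) => [re0|re0]; [right|left]; apply: contra_neq v0.
  + move=> /B0 im0; apply/rowP => j; rewrite !mxE; apply/eqP; rewrite eq_complex /=.
    by have := congr1 (fun u : 'rV[R]__ => u 0 j) re0;
      have := congr1 (fun u : 'rV[R]__ => u 0 j) im0; rewrite !mxE => -> ->; rewrite eqxx.
  + by move=> /B0 re0'; rewrite re0' eqxx in re0.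
- by rewrite (submx_trans (submxMl _ _)) ?eq_row_base.
- by rewrite (submx_trans (submxMl _ _)) ?eq_row_base.
- rewrite -mulmxA AB mulmxA !scalemxAl -mulmxBl; congr (_ *m _).
  by apply/rowP => j; rewrite reA !mxE.
- rewrite -mulmxA AB mulmxA !scalemxAl -mulmxDl; congr (_ *m _).
  by apply/rowP => j; rewrite imA !mxE.
Qed.

End Eigenvectors.

Lemma mxform_ext (K : comNzRingType) n (A B : 'M[K]_n) :
  (forall X Y, mxform A X Y = mxform B X Y) -> A = B.
Proof. by move=> AB; apply/matrixP => i j; rewrite -!mxform_delta AB. Qed.

Section LorentzForm.
Variables (R : rcfType) (h : 'M[R]_4).
Hypothesis h_sym : forall X Y, mxform h X Y = mxform h Y X.
Hypothesis h_nd : forall X, (forall Y, mxform h X Y = 0) -> X = 0.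
Variable P : 'M[R]_(3 + 1).
Hypothesis P_unit : P \in unitmx.
Hypothesis P_diag : P *m (h : 'M[R]_(3 + 1)) *m P^T = block_mx 1%:M 0 0 (- 1%:M).

Lemma lorentzE (X Y : 'rV[R]_(3 + 1)) : mxform h (X *m P) (Y *m P) =
  X 0 (inord 0) * Y 0 (inord 0) + X 0 (inord 1) * Y 0 (inord 1) +
  X 0 (inord 2) * Y 0 (inord 2) - X 0 (inord 3) * Y 0 (inord 3).
Proof.
rewrite -[LHS](@mxform_mul _ _ P h) P_diag /mxform.
rewrite -[X in X *m _ *m _](hsubmxK X) -[X in _ *m X^T](hsubmxK Y) tr_row_mx.
rewrite mul_row_block !mulmx0 addr0 add0r mul_row_col mulmx1 mulmxN mulNmx mulmx1.
rewrite !mxE !big_ord_recl !big_ord0 /= !mxE !addr0 !addrA.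
by congr (_ * _ + _ * _ + _ * _ - _ * _); congr (_ 0 _);
  apply: val_inj; rewrite /= inordK.
Qed.

(** In coordinates with form diag(1, 1, 1, -1), Lagrange's identity writes a3^2 h(X, X) as the sum
    of the squared 2 x 2 minors of the spatial parts. It is positive unless these parts are
    proportional, and then orthogonality makes [X] proportional to [m]. *)
Lemma causal m X : m != 0 -> mxform h m m = 0 -> mxform h m X = 0 ->
  0 < mxform h X X \/ exists c, X = c *: m.
Proof.
rewrite -(mulmxKV P_unit m) -(mulmxKV P_unit X).
set m' := _ *m invmx P; set X' := _ *m invmx P; rewrite !lorentzE.
pose a0 := m' 0 (inord 0); pose a1 := m' 0 (inord 1); pose a2 := m' 0 (inord 2).
pose a3 := m' 0 (inord 3).
pose b0 := X' 0 (inord 0); pose b1 := X' 0 (inord 1); pose b2 := X' 0 (inord 2).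
pose b3 := X' 0 (inord 3).
rewrite -/a0 -/a1 -/a2 -/a3 -/b0 -/b1 -/b2 -/b3 => m0 mm mX.
have a3n0 : a3 != 0.
  apply: contra_neq m0 => a30.
  have e : a0 ^+ 2 + a1 ^+ 2 + a2 ^+ 2 = 0 by rewrite a30 in mm; nra.
  have a00 : a0 = 0 by nra.
  have a10 : a1 = 0 by nra.
  have a20 : a2 = 0 by nra.
  suff -> : m' = 0 by rewrite mul0mx.
  apply/rowP => -[[|[|[|[|//]]]] i4]; rewrite [RHS]mxE.
  - by rewrite -[RHS]a00; congr (m' 0 _); apply: val_inj; rewrite /= inordK.
  - by rewrite -[RHS]a10; congr (m' 0 _); apply: val_inj; rewrite /= inordK.
  - by rewrite -[RHS]a20; congr (m' 0 _); apply: val_inj; rewrite /= inordK.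
  - by rewrite -[RHS]a30; congr (m' 0 _); apply: val_inj; rewrite /= inordK.
have lagrange : a3 ^+ 2 * (b0 * b0 + b1 * b1 + b2 * b2 - b3 * b3) =
    (a0 * b1 - a1 * b0) ^+ 2 + (a0 * b2 - a2 * b0) ^+ 2 + (a1 * b2 - a2 * b1) ^+ 2.
  have e1 : a3 ^+ 2 = a0 ^+ 2 + a1 ^+ 2 + a2 ^+ 2 by nra.
  have e2 : (a3 * b3) ^+ 2 = (a0 * b0 + a1 * b1 + a2 * b2) ^+ 2 by congr (_ ^+ 2); nra.
  transitivity (a3 ^+ 2 * (b0 * b0 + b1 * b1 + b2 * b2) - (a3 * b3) ^+ 2); first by ring.
  by rewrite e1 e2; ring.
have a32 : 0 < a3 ^+ 2 by rewrite exprn_even_gt0.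
case: (ltP 0 (b0 * b0 + b1 * b1 + b2 * b2 - b3 * b3)) => [|le0]; [by left|right].
have sum0 : (a0 * b1 - a1 * b0) ^+ 2 + (a0 * b2 - a2 * b0) ^+ 2 +
    (a1 * b2 - a2 * b1) ^+ 2 <= 0.
  by rewrite -lagrange pmulr_rle0.
have s01 := sqr_ge0 (a0 * b1 - a1 * b0).
have s02 := sqr_ge0 (a0 * b2 - a2 * b0).
have s12 := sqr_ge0 (a1 * b2 - a2 * b1).
have e01 : a0 * b1 = a1 * b0 by apply/eqP; rewrite -subr_eq0 -sqrf_eq0; apply/eqP; lra.
have e02 : a0 * b2 = a2 * b0 by apply/eqP; rewrite -subr_eq0 -sqrf_eq0; apply/eqP; lra.
have e12 : a1 * b2 = a2 * b1 by apply/eqP; rewrite -subr_eq0 -sqrf_eq0; apply/eqP; lra.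
have e1 : a3 ^+ 2 = a0 ^+ 2 + a1 ^+ 2 + a2 ^+ 2 by nra.
have e2 : a3 * b3 = a0 * b0 + a1 * b1 + a2 * b2 by nra.
exists (b3 / a3); rewrite scalemxAl; congr (_ *m P).
have H x y : a3 ^+ 2 * x = a3 * b3 * y -> x = b3 / a3 * y.
  move=> e; apply: (mulfI (lt0r_neq0 a32)); rewrite e.
  by field.
apply/rowP => -[[|[|[|[|//]]]] i4]; rewrite [RHS]mxE; apply: H; rewrite ?e1 ?e2.
- rewrite (_ : Ordinal i4 = inord 0); last by apply: val_inj; rewrite /= inordK.
  rewrite -/a0 -/b0.
  by have := congr1 ( *%R a1) e01; have := congr1 ( *%R a2) e02; lra.
- rewrite (_ : Ordinal i4 = inord 1); last by apply: val_inj; rewrite /= inordK.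
  rewrite -/a1 -/b1.
  by have := congr1 ( *%R a0) e01; have := congr1 ( *%R a2) e12; lra.
- rewrite (_ : Ordinal i4 = inord 2); last by apply: val_inj; rewrite /= inordK.
  rewrite -/a2 -/b2.
  by have := congr1 ( *%R a0) e02; have := congr1 ( *%R a1) e12; lra.
- rewrite (_ : Ordinal i4 = inord 3); last by apply: val_inj; rewrite /= inordK.
  rewrite -/a3 -/b3 -e2 -e1; ring.
Qed.

Lemma spacelike a b X : mxform h a a = 0 -> mxform h b b = 0 ->
  mxform h a b != 0 -> mxform h a X = 0 -> mxform h b X = 0 -> X != 0 ->
  0 < mxform h X X.
Proof.
move=> aa bb ab aX bX X0.
have a0 : a != 0 by apply: contra_neq ab => ->; rewrite !mxformE.
case: (causal a0 aa aX) => // -[c Xc].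
move: bX; rewrite Xc !mxformE h_sym => /eqP; rewrite mulf_eq0 (negbTE ab) orbF.
by move=> /eqP c0; move: X0; rewrite Xc c0 scale0r eqxx.
Qed.

Lemma orth3 X Y Z : exists2 v, v != 0 &
  [/\ mxform h X v = 0, mxform h Y v = 0 & mxform h Z v = 0].
Proof.
pose A := h *m (col_mx X (col_mx Y Z))^T.
have : kermx A != 0.
  rewrite -mxrank_eq0 mxrank_ker subn_eq0 -ltnNge ltnS.
  exact: (leq_trans (rank_leq_col _)).
move=> /rowV0Pn[v /sub_kermxP vA v0]; exists v => //.
move: vA; rewrite /A !tr_col_mx mulmxA !mul_mx_row.
rewrite -[0]row_mx0 => /eq_row_mx[vX]; rewrite -[0]row_mx0 => /eq_row_mx[vY vZ].
by split; rewrite h_sym /mxform ?vX ?vY ?vZ mxE.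
Qed.

Lemma null_partner a : a != 0 -> mxform h a a = 0 ->
  exists2 b, mxform h b b = 0 & mxform h a b != 0.
Proof.
move=> a0 aa.
have [y ay] : exists y, mxform h a y != 0.
  apply: contrapT => H; move: a0; rewrite (@h_nd a) ?eqxx // => y.
  by apply: contrapT => /eqP ay; apply: H; exists y.
(* Adding a multiple of the null vector [a] keeps h(a, y) and changes h(y, y) linearly; this
   multiple cancels it. *)
exists (y - (mxform h y y / (2 * mxform h a y)) *: a).
  rewrite !mxformE aa (h_sym y a); field.
  by [].
by rewrite !mxformE aa mulr0 oppr0 addr0.
Qed.

Section Frame.
Variables (a b f g : 'rV[R]_4).
Hypotheses (aa : mxform h a a = 0) (bb : mxform h b b = 0)
  (ab : mxform h a b != 0) (ff : mxform h f f != 0) (gg : mxform h g g != 0)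
  (af : mxform h a f = 0) (bf : mxform h b f = 0)
  (ag : mxform h a g = 0) (bg : mxform h b g = 0) (fg : mxform h f g = 0).

Let F : 'M[R]_4 := \matrix_i nth 0 [:: a; f; g; b] i.

Lemma frame_lin (v : 'rV[R]_4) : v *m F =
  v 0 (inord 0) *: a + v 0 (inord 1) *: f + v 0 (inord 2) *: g + v 0 (inord 3) *: b.
Proof.
rewrite mulmx_sum_row !big_ord_recl big_ord0 !rowK /= addr0 !addrA.
by congr (_ *: _ + _ *: _ + _ *: _ + _ *: _); congr (v 0 _); apply: val_inj;
  rewrite /= inordK.
Qed.

Lemma frame_unit : F \in unitmx.
Proof.
rewrite -row_free_unit; apply: inj_row_free => v; rewrite frame_lin => v0.
have e x := congr1 (mxform h x) v0.
have := e a; rewrite !mxformE aa af ag !mulr0 !add0r => /eqP.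
rewrite mulf_eq0 (negbTE ab) orbF => /eqP v3.
have := e b; rewrite !mxformE bb bf bg !mulr0 !addr0 h_sym => /eqP.
rewrite mulf_eq0 (negbTE ab) orbF => /eqP vv0.
have := e f; rewrite !mxformE (h_sym f a) (h_sym f b) bf af fg !mulr0 add0r !addr0 => /eqP.
rewrite mulf_eq0 (negbTE ff) orbF => /eqP v1.
have := e g; rewrite !mxformE (h_sym g a) (h_sym g b) (h_sym g f) bg ag fg !mulr0 !add0r addr0.
move=> /eqP; rewrite mulf_eq0 (negbTE gg) orbF => /eqP v2.
apply/rowP => -[[|[|[|[|//]]]] i4]; rewrite [RHS]mxE.
- by rewrite -[RHS]vv0; congr (v 0 _); apply: val_inj; rewrite /= inordK.
- by rewrite -[RHS]v1; congr (v 0 _); apply: val_inj; rewrite /= inordK.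
- by rewrite -[RHS]v2; congr (v 0 _); apply: val_inj; rewrite /= inordK.
- by rewrite -[RHS]v3; congr (v 0 _); apply: val_inj; rewrite /= inordK.
Qed.

Lemma frame_expand x : exists c0 c1 c2 c3,
  x = c0 *: a + c1 *: f + c2 *: g + c3 *: b.
Proof.
exists ((x *m invmx F) 0 (inord 0)), ((x *m invmx F) 0 (inord 1)),
  ((x *m invmx F) 0 (inord 2)), ((x *m invmx F) 0 (inord 3)).
by rewrite -frame_lin mulmxKV // frame_unit.
Qed.

Lemma frame_nd (w : 'M[R]_4) x : (forall X, (forall Y, mxform w X Y = 0) -> X = 0) ->
  mxform w x a = 0 -> mxform w x f = 0 -> mxform w x g = 0 -> mxform w x b = 0 -> x = 0.
Proof.
move=> nd xa xf xg xb; apply: nd => y.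
have [c0 [c1 [c2 [c3 ->]]]] := frame_expand y.
by rewrite !mxformE xa xf xg xb !mulr0 !addr0.
Qed.

End Frame.

End LorentzForm.

Section Lorentz.
Variables (R : rcfType) (h S w : 'M[R]_4) (l : nat).
Hypothesis h_sym : forall X Y, mxform h X Y = mxform h Y X.
Hypothesis h_nd : forall X, (forall Y, mxform h X Y = 0) -> X = 0.
Variable P : 'M[R]_(3 + 1).
Hypothesis P_unit : P \in unitmx.
Hypothesis P_diag : P *m (h : 'M[R]_(3 + 1)) *m P^T = block_mx 1%:M 0 0 (- 1%:M).
Hypothesis S_sym : forall X Y, mxform h (X *m S) Y = mxform h X (Y *m S).

(** The complement of the hyperbolic plane is positive definite, so the form h(. S, .) restricted to
    it has an orthogonal diagonalizing basis. The plane itself need not be invariant under [S]. *)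
Lemma diagonal_frame a b : mxform h a a = 0 -> mxform h b b = 0 -> mxform h a b != 0 ->
  exists f g, [/\ 0 < mxform h f f, 0 < mxform h g g,
    [/\ mxform h a f = 0, mxform h b f = 0, mxform h a g = 0 & mxform h b g = 0],
    mxform h f g = 0 & mxform h (f *m S) g = 0].
Proof.
move=> aa bb ab.
have [f f0 [af bf _]] := orth3 h_sym a b a.
have [g g0 [ag bg fg]] := orth3 h_sym a b f.
have fp := spacelike h_sym P_unit P_diag aa bb ab af bf f0.
have gp := spacelike h_sym P_unit P_diag aa bb ab ag bg g0.
set p := mxform h f f in fp *; set q := mxform h g g in gp *.
(* A x^2 + B x y + C y^2 is h(f' S, g') for f' = x f + y g and g' = - y q f + x p g, which is
   orthogonal to f'. Since [p] and [q] are positive, A C <= 0 and a real root exists. *)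
pose A := p * mxform h (f *m S) g.
pose B := p * mxform h (g *m S) g - q * mxform h (f *m S) f.
pose C := - (q * mxform h (f *m S) g).
have [A0|A0] := eqVneq (mxform h (f *m S) g) 0; first by exists f, g; split.
pose D := B ^+ 2 - 4 * (A * C).
have D0 : 0 <= D.
  have : 0 <= p * q * mxform h (f *m S) g ^+ 2.
    by rewrite mulr_ge0 ?sqr_ge0 // mulr_ge0 // ltW.
  by rewrite /D /A /C; have := sqr_ge0 B; nra.
pose x := - B + Num.sqrt D; pose y := 2 * A.
have xy : A * x ^+ 2 + B * x * y + C * y ^+ 2 = 0.
  have := sqr_sqrtr D0; rewrite /x /y; set r := Num.sqrt D => e.
  have -> : A * (- B + r) ^+ 2 + B * (- B + r) * (2 * A) + C * (2 * A) ^+ 2 =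
    A * (r ^+ 2 - (B ^+ 2 - 4 * (A * C))) by ring.
  by rewrite e subrr mulr0.
have y0 : y != 0 by rewrite mulf_neq0 ?pnatr_eq0 // mulf_neq0 // gt_eqF.
have y2 : 0 < y ^+ 2 by rewrite exprn_even_gt0.
have hh : mxform h (g *m S) f = mxform h (f *m S) g by rewrite S_sym h_sym.
exists (x *: f + y *: g), (- (y * q) *: f + (x * p) *: g); split.
- rewrite !mxformE (h_sym g f) fg -/p -/q !(mulr0, addr0, add0r).
  have : 0 < y ^+ 2 * q by rewrite mulr_gt0.
  have : 0 <= x ^+ 2 * p by rewrite mulr_ge0 ?sqr_ge0 // ltW.
  by lra.
- rewrite !mxformE (h_sym g f) fg -/p -/q !(mulr0, addr0, add0r).
  have : 0 < y ^+ 2 * q ^+ 2 * p by rewrite mulr_gt0 // mulr_gt0 // exprn_gt0.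
  have : 0 <= x ^+ 2 * p ^+ 2 * q by rewrite mulr_ge0 ?(ltW gp) // mulr_ge0 ?sqr_ge0.
  by lra.
- by rewrite !mxformE af bf ag bg !mulr0 !addr0.
- by rewrite !mxformE (h_sym g f) fg -/p -/q; ring.
- rewrite mulmxDl -!scalemxAl !mxformE hh; move: xy; rewrite /A /B /C; lra.
Qed.

Hypothesis w_alt : forall X, mxform w X X = 0.
Hypothesis w_nd : forall X, (forall Y, mxform w X Y = 0) -> X = 0.
Hypothesis T0 : forall s, curv h S w l s = 0.

Lemma alt_skew (w' : 'M[R]_4) X Y : (forall X, mxform w' X X = 0) ->
  mxform w' X Y = - mxform w' Y X.
Proof.
move=> alt; have := alt (X + Y); rewrite !mxformE !alt.
by rewrite add0r addr0 => /eqP; rewrite addr_eq0 => /eqP.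
Qed.

(* The operator gauss (x+, x-) is invertible on the invariant plane and vanishes
   on its orthogonal complement; x+ and x- are its eigenvectors, with real
   eigenvalues although those of S on this plane are not. *)
Lemma complex_plane a b la mu :
  mxform h a a = 0 -> mxform h b b = 0 -> mxform h a b != 0 ->
  a *m S = la *: a - mu *: b -> b *m S = mu *: a + la *: b -> mu = 0.
Proof.
move=> aa bb ab aS bS; apply/eqP; apply: contraT => mu0; exfalso.
have [f [g [fp gp [af bf ag bg] fg fSg]]] := diagonal_frame aa bb ab.
have k0 := ab; set k := mxform h a b in k0.
have nu0 : 0 <= la ^+ 2 + mu ^+ 2 by rewrite addr_ge0 ?sqr_ge0.
pose r := Num.sqrt (la ^+ 2 + mu ^+ 2).
have r2 : r ^+ 2 = la ^+ 2 + mu ^+ 2 by rewrite sqr_sqrtr.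
have r0 : r != 0 by rewrite -sqrf_eq0 r2 gt_eqF // ltr_wpDl ?sqr_ge0 // exprn_even_gt0.
(* On the plane, rho(a, b) is k times the matrix with rows (la, -mu) and (-mu, -la), symmetric and
   traceless with eigenvalues r and -r. Its eigenvectors are [xp] and [xm], and rho(xp, xm) = 2 mu r
   rho(a, b). *)
pose xp := mu *: a + (la - r) *: b; pose xm := mu *: a + (la + r) *: b.
have hxx : [/\ mxform h xp xp = 2 * k * mu * (la - r),
    mxform h xm xp = 2 * k * mu * la, mxform h xp xm = 2 * k * mu * la &
    mxform h xm xm = 2 * k * mu * (la + r)].
  by rewrite /xp /xm !mxformE aa bb (h_sym b a) -/k; split; ring.
have [pp mp pm mm] := hxx.
pose e := 2 * k * mu * r ^+ 2.
have ep : gauss h S xp xm xp = e *: xp.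
  rewrite /gauss mp pp /xp /xm !mulmxDl -!scalemxAl aS bS.
  by apply/rowP => i; rewrite !mxE /e; ring: r2.
have em : gauss h S xp xm xm = (- e) *: xm.
  rewrite /gauss mm pm /xp /xm !mulmxDl -!scalemxAl aS bS.
  by apply/rowP => i; rewrite !mxE /e; ring: r2.
have e0 : e != 0 by rewrite /e !mulf_neq0 // ?pnatr_eq0 // expf_neq0.
have ef x : mxform h a x = 0 -> mxform h b x = 0 -> gauss h S xp xm x = 0 *: x.
  move=> ax bx; rewrite /gauss /xp /xm !mxformE ax bx !mulr0 !addr0 !scale0r.
  by rewrite subrr.
have wx x c z : gauss h S xp xm x = c *: x -> c != 0 -> mxform h a z = 0 ->
    mxform h b z = 0 -> mxform w x z = 0.
  move=> ex c0 az bz.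
  apply: (@curv_eigen _ _ h S w l 0 xp xm (cons2 x z (fun=> 0)) e (- e)
    (cons2 c 0 (fun=> 0)) T0 ep em).
    by move=> [|[|i]] //= _; apply: ef.
  by move=> j; rewrite subrr mulr0 add0r !big_ord_recl big_ord0 /= !addr0.
have e0' : - e != 0 by rewrite oppr_eq0.
have wpf := wx _ _ f ep e0 af bf; have wpg := wx _ _ g ep e0 ag bg.
have fS : exists df, f *m S = df *: f.
  have [c0 [c1 [c2 [c3 fE]]]] := frame_expand h_sym aa bb ab
    (lt0r_neq0 fp) (lt0r_neq0 gp) af bf ag bg fg (f *m S).
  exists c1; rewrite fE.
  have ha : mxform h (f *m S) a = 0.
    by rewrite S_sym aS !mxformE (h_sym f a) (h_sym f b) af bf !mulr0 subrr.
  have hb : mxform h (f *m S) b = 0.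
    by rewrite S_sym bS !mxformE (h_sym f a) (h_sym f b) af bf !mulr0 addr0.
  move: ha hb fSg; rewrite fE !mxformE aa bb fg (h_sym f a) (h_sym f b) (h_sym g a).
  rewrite (h_sym g b) af bf ag bg (h_sym b a) !mulr0 !add0r !addr0.
  move=> /eqP; rewrite mulf_eq0 (negbTE ab) orbF => /eqP ->.
  move=> /eqP; rewrite mulf_eq0 (negbTE ab) orbF => /eqP ->.
  move=> /eqP; rewrite mulf_eq0 (gt_eqF gp) orbF => /eqP ->.
  by rewrite !scale0r add0r !addr0.
have [df fS'] := fS.
(* The component of R omega on (xp, f, xp, f) has weight 2e and vanishes. It is a multiple of w(xp,
   xp S), because rho(xp, f) sends [f] to h(f, f) xp S and [xp] to a multiple of [f]. *)
have wS : mxform w xp (xp *m S) = 0.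
  have := @curv_eigen _ _ h S w l 1 xp xm (cons2 xp f (cons2 xp f (fun=> 0))) e (- e)
    (cons2 e 0 (cons2 e 0 (fun=> 0))) T0 ep em.
  have -> : curv h S w 1 (cons2 xp f (cons2 xp f (fun=> 0))) =
      - (mxform h f f * mxform w xp (xp *m S)).
    have hxf : mxform h xp f = 0 by rewrite /xp !mxformE af bf !mulr0 addr0.
    rewrite curv_cons2 dact_cons2 /dact big_ord0 addr0 /= !curv0 /gauss.
    by rewrite hxf (h_sym f xp) hxf fS' !scale0r subr0 sub0r !mxformE w_alt !mulr0 oppr0 add0r.
  move=> H; have /eqP : - (mxform h f f * mxform w xp (xp *m S)) = 0.
    apply: H; first by case=> [|[|[|[|i]]]] //= _; apply: ef.
    move=> j; rewrite subrr mulr0 add0r !big_ord_recl big_ord0 /= !addr0 !add0r.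
    by rewrite -mulr2n mulrn_eq0.
  by rewrite oppr_eq0 mulf_eq0 (gt_eqF fp) => /eqP.
have wab : mxform w a b = 0.
  move: wS; rewrite /xp mulmxDl -!scalemxAl aS bS !mxformE !w_alt.
  rewrite (alt_skew b a w_alt) => wS.
  have : mu * (mu ^+ 2 + (la - r) ^+ 2) * mxform w a b = 0 by lra.
  move=> /eqP; rewrite !mulf_eq0 (negbTE mu0) /= => /orP[|/eqP //].
  by rewrite gt_eqF // ltr_wpDr ?sqr_ge0 // exprn_even_gt0.
have : xp = 0.
  apply: (frame_nd h_sym aa bb ab (lt0r_neq0 fp)
    (lt0r_neq0 gp) af bf ag bg fg w_nd) => //.
  - by rewrite /xp !mxformE w_alt (alt_skew b a w_alt) wab oppr0 !mulr0 addr0.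
  - by rewrite /xp !mxformE w_alt wab !mulr0 addr0.
move=> /(congr1 (mxform h b)); rewrite /xp !mxformE bb mulr0 addr0 h_sym -/k => /eqP.
by rewrite mulf_eq0 (negbTE mu0) (negbTE k0).
Qed.

End Lorentz.

(** * Leading parts with respect to a null frame *)

Section LeadingFrame.
Variables (R : rcfType) (h S w : 'M[R]_4) (l : nat).
Hypothesis h_sym : forall X Y, mxform h X Y = mxform h Y X.
Hypothesis w_alt : forall X, mxform w X X = 0.
Hypothesis T0 : forall s, curv h S w l s = 0.
Variables (a b f g : 'rV[R]_4) (d df dg cf cg be ga de : R).
Hypotheses (aS : a *m S = d *: a) (fS : f *m S = cf *: a + df *: f)
  (gS : g *m S = cg *: a + dg *: g)
  (bS : b *m S = be *: a + ga *: f + de *: g + d *: b).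
Hypotheses (aa : mxform h a a = 0) (bb : mxform h b b = 0)
  (ab : mxform h a b != 0) (ff : mxform h f f != 0) (gg : mxform h g g != 0)
  (af : mxform h a f = 0) (bf : mxform h b f = 0)
  (ag : mxform h a g = 0) (bg : mxform h b g = 0) (fg : mxform h f g = 0).

Let v (i : nat) : 'rV[R]_4 := nth 0 [:: a; f; g; b] i.
Let F : 'M[R]_4 := \matrix_i v i.
Let wt (i : nat) : nat := nth 0 [:: 2; 1; 1; 0] i.

(* wt is the weight for the boost of the null plane (a, b), shifted by 1 *)
Variable c : nat.
Hypothesis w_le : forall i j : 'I_4, mxform w (v i) (v j) != 0 -> (wt i + wt j <= c)%N.

Let h' := F *m h *m F^T.
Let w' := F *m w *m F^T.
Let S0 : 'M[R]_4 := diag_mx (\row_i nth 0 [:: d; df; dg; d] i).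
Let wc : 'M[R]_4 := \matrix_(i, j) if (wt i + wt j == c)%N then w' i j else 0.

Let delta_F i : delta_mx 0 i *m F = v i.
Proof. by rewrite -rowE rowK. Qed.

Let formE (A : 'M[R]_4) i j : (F *m A *m F^T) i j = mxform A (v i) (v j).
Proof. by rewrite -mxform_delta mxform_mul !delta_F. Qed.

(** In the frame (a, f, g, b) the operator never lowers the weight and does not mix [f] and [g], so
    its leading part is the diagonal matrix [S0]. The non-zero entries of [h] have total weight 2,
    since boosts preserve [h]. *)
Let leading_frame0 s : curv h' S0 wc l s = 0.
Proof.
pose S' : 'M[R]_4 := \matrix_(i, j) nth 0 (nth [::] [:: [:: d; 0; 0; 0];
  [:: cf; df; 0; 0]; [:: cg; 0; dg; 0]; [:: be; ga; de; d]] i) j.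
have -> : S0 = \matrix_(i, j) if wt i == wt j then S' i j else 0.
  apply/matrixP => -[[|[|[|[|//]]]] i4] [[|[|[|[|//]]]] j4]; rewrite !mxE /=;
    by rewrite ?mulr1n ?mulr0n.
apply: (@curv_leading R 4 h' S' w' wt 2) => [i j|i j|i j|{}s].
- rewrite formE; case: i j => -[|[|[|[|//]]]] i4 [[|[|[|[|//]]]] j4]; rewrite /v /wt /=;
  rewrite ?aa ?bb ?af ?ag ?bf ?bg ?fg ?(h_sym f a) ?(h_sym g a) ?(h_sym f b);
  by rewrite ?(h_sym g b) ?(h_sym g f) ?af ?ag ?bf ?bg ?fg ?eqxx.
- by case: i j => -[|[|[|[|//]]]] i4 [[|[|[|[|//]]]] j4]; rewrite mxE /wt /= ?eqxx.
- by rewrite formE; apply: w_le.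
- rewrite (@curv_intertwine _ _ F h S S' w) ?T0 //.
  apply/row_matrixP => i; rewrite !row_mul rowK frame_lin !mxE !inordK //.
  case: i => -[|[|[|[|//]]]] i4; rewrite /v /= ?aS ?fS ?gS ?bS ?scale0r ?addr0 ?add0r //.
Qed.

Let hd i j : mxform h' (delta_mx 0 i) (delta_mx 0 j) = mxform h (v i) (v j).
Proof. by rewrite mxform_mul !delta_F. Qed.

Let wd i j : mxform wc (delta_mx 0 i) (delta_mx 0 j) =
  if (wt i + wt j == c)%N then mxform w (v i) (v j) else 0.
Proof. by rewrite mxform_delta mxE formE. Qed.

Let Sd (i : 'I_4) : (delta_mx 0 i : 'rV[R]_4) *m S0 = nth 0 [:: d; df; dg; d] i *: delta_mx 0 i.
Proof.
apply/rowP => j; rewrite mul_mx_diag !mxE mulrC.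
by rewrite eqxx /=; case: (eqVneq j i) => [->//|_]; rewrite !mulr0.
Qed.

Let h'_sym X Y : mxform h' X Y = mxform h' Y X.
Proof. by rewrite !mxform_mul h_sym. Qed.

Let o1 : 'I_4 := Ordinal (isT : (1 < 4)%N).
Let o2 : 'I_4 := Ordinal (isT : (2 < 4)%N).
Let o3 : 'I_4 := Ordinal (isT : (3 < 4)%N).

(** The guards select the components that survive in the leading part of weight [c]. Once those of
    weight 3 are known to vanish, [c] may be lowered to 2. *)
Lemma leading_null : d != 0 -> [/\ (3 == c)%N -> mxform w a f = 0,
  (3 == c)%N -> mxform w a g = 0 & (2 == c)%N -> mxform w a b = 0].
Proof.
move=> d0.
have := @null_frame_orth _ _ h' S0 wc l h'_sym leading_frame0 (delta_mx 0 ord0)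
  (delta_mx 0 o3) (delta_mx 0 o1) (delta_mx 0 o2) d df dg (Sd _) (Sd _) (Sd _) (Sd _).
rewrite !hd !wd /v /wt /= => H; have [H1 H2 H3] := H aa bb ab ff gg fg af bf ag bg d0.
split=> [e|e|e]; rewrite ?e in H1 H2 H3 => //.
apply: H3; rewrite ?(alt_skew b a w_alt) //.
- by rewrite w_alt if_same.
- by rewrite w_alt if_same.
Qed.

Lemma leading_space : df != 0 -> [/\ (3 == c)%N -> mxform w f a = 0,
  (2 == c)%N -> mxform w f g = 0 & (1 == c)%N -> mxform w f b = 0].
Proof.
move=> d0.
have := @space_orth _ _ h' S0 wc l h'_sym leading_frame0 (delta_mx 0 ord0)
  (delta_mx 0 o3) (delta_mx 0 o1) (delta_mx 0 o2) d df dg (Sd _) (Sd _) (Sd _) (Sd _).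
rewrite !hd !wd /v /wt /= => H; have [H1 H2 H3] := H aa bb ab ff gg fg af bf ag bg d0.
by split=> e; rewrite ?e in H1 H2 H3.
Qed.

End LeadingFrame.

Section Reflection.
Variables (R : realFieldType) (n : nat) (h S w : 'M[R]_n) (l : nat).
Hypothesis h_sym : forall X Y, mxform h X Y = mxform h Y X.
Hypothesis S_sym : forall X Y, mxform h (X *m S) Y = mxform h X (Y *m S).
Hypothesis T0 : forall s, curv h S w l s = 0.
Variables (f : 'rV[R]_n) (d : R).
Hypotheses (fS : f *m S = d *: f) (ff : mxform h f f != 0).

(* The part of w that is odd under the reflection in the hyperplane orthogonal to
   f, which is an isometry of h commuting with S *)
Lemma odd_part : exists2 w' : 'M[R]_n, forall s, curv h S w' l s = 0 &
  [/\ (forall X, mxform w X X = 0) -> forall X, mxform w' X X = 0,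
      forall X Y, mxform h X f = 0 -> mxform h Y f = 0 -> mxform w' X Y = 0 &
      forall Y, mxform h Y f = 0 -> mxform w' f Y = 2 * mxform w f Y].
Proof.
pose Q : 'M[R]_n := 1%:M - (2 / mxform h f f) *: (h *m f^T *m f).
have XQ X : X *m Q = X - (2 / mxform h f f * mxform h X f) *: f.
  rewrite mulmxBr mulmx1 -scalemxAr !mulmxA [X *m h *m f^T]mx11_scalar.
  by rewrite mul_scalar_mx scalerA.
have QS : S *m Q = Q *m S.
  apply/row_matrixP => i; rewrite !row_mul !rowE.
  set X : 'rV_n := delta_mx _ _.
  by rewrite !XQ mulmxBl -scalemxAl fS S_sym fS mxformZr scalerA; congr (_ - _ *: _); ring.
have Qh : Q *m h *m Q^T = h.
  apply: mxform_ext => X Y; rewrite mxform_mul !XQ !mxformE (h_sym f Y).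
  by field.
exists (w - Q *m w *m Q^T).
  move=> s; rewrite curvB T0 -[in X in curv X]Qh (@curv_intertwine _ _ Q h S S) //.
  by rewrite T0 subrr.
have wE X Y : mxform (w - Q *m w *m Q^T) X Y =
    mxform w X Y - mxform w (X *m Q) (Y *m Q).
  by rewrite -mxform_mul /mxform mulmxBr mulmxBl !mxE.
split=> [alt X|X Y Xf Yf|Y Yf]; rewrite wE.
- by rewrite !alt subrr.
- by rewrite !XQ Xf Yf !mulr0 !scale0r !subr0 subrr.
- rewrite !XQ Yf mulr0 scale0r subr0 divfK // !mxformE; ring.
Qed.

End Reflection.

(** * Operators with a null eigenvector *)

Section NullEigenvector.
Variables (R : rcfType) (h S w : 'M[R]_4) (l : nat).
Hypothesis h_sym : forall X Y, mxform h X Y = mxform h Y X.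
Hypothesis h_nd : forall X, (forall Y, mxform h X Y = 0) -> X = 0.
Variable P : 'M[R]_(3 + 1).
Hypothesis P_unit : P \in unitmx.
Hypothesis P_diag : P *m (h : 'M[R]_(3 + 1)) *m P^T = block_mx 1%:M 0 0 (- 1%:M).
Hypothesis S_sym : forall X Y, mxform h (X *m S) Y = mxform h X (Y *m S).
Hypothesis w_alt : forall X, mxform w X X = 0.
Hypothesis w_nd : forall X, (forall Y, mxform w X Y = 0) -> X = 0.
Hypothesis T0 : forall s, curv h S w l s = 0.

Section Frame.
Variables (a b f g : 'rV[R]_4).
Hypotheses (aa : mxform h a a = 0) (bb : mxform h b b = 0)
  (ab : mxform h a b != 0) (ff : mxform h f f != 0) (gg : mxform h g g != 0)
  (af : mxform h a f = 0) (bf : mxform h b f = 0)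
  (ag : mxform h a g = 0) (bg : mxform h b g = 0) (fg : mxform h f g = 0).

(** Self-adjointness moves [S] to the frame vector: pairing with the eigenvector [a] gives the
    coefficient along [b], and pairing with [f] and [g] gives theirs. *)
Lemma null_frame_expand d x : a *m S = d *: a -> exists c0 c1 c2,
  [/\ x *m S = c0 *: a + c1 *: f + c2 *: g + (d * mxform h x a / mxform h a b) *: b,
    c1 = mxform h x (f *m S) / mxform h f f &
    c2 = mxform h x (g *m S) / mxform h g g].
Proof.
move=> aS; have [c0 [c1 [c2 [c3 xE]]]] :=
  frame_expand h_sym aa bb ab ff gg af bf ag bg fg (x *m S).
exists c0, c1, c2; rewrite -!S_sym xE.
have -> : d * mxform h x a = c3 * mxform h a b.
  rewrite -mxformZr -aS -S_sym xE !mxformE aa (h_sym f a) (h_sym g a) (h_sym b a) af ag.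
  by rewrite !mulr0 !add0r.
rewrite mulfK //; split=> //.
  by rewrite !mxformE af bf (h_sym g f) fg !mulr0 add0r !addr0 mulfK.
by rewrite !mxformE ag bg fg !mulr0 !add0r !addr0 mulfK.
Qed.

(** If d is non-zero, w(a, f) and w(a, g) vanish at weight 3, then w(a, b) at weight 2, so [a] is in
    the radical of [w]. Weight 4 occurs only for the pair (a, a), where [w] is zero. *)
Lemma null_eigenvalue0 d df dg cf cg : a *m S = d *: a ->
  f *m S = cf *: a + df *: f -> g *m S = cg *: a + dg *: g -> d = 0.
Proof.
move=> aS fS gS; apply/eqP; apply: contraT => d0; exfalso.
have [be [ga [de [bS _ _]]]] := null_frame_expand b aS.
rewrite (h_sym b a) mulfK // in bS.
have L := @leading_null _ h S w l h_sym w_alt T0 a b f g d df dg cf cg be ga de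
  aS fS gS bS aa bb ab ff gg af bf ag bg fg.
have [] := L 3%N; [|by []|move=> /(_ isT) waf /(_ isT) wag _].
  by move=> [[|[|[|[|//]]]] i4] [[|[|[|[|//]]]] j4] //=; rewrite w_alt eqxx.
have wfa : mxform w f a = 0 by rewrite (alt_skew f a w_alt) waf oppr0.
have wga : mxform w g a = 0 by rewrite (alt_skew g a w_alt) wag oppr0.
have [] := L 2%N; [|by []|move=> _ _ /(_ isT) wab].
  move=> [[|[|[|[|//]]]] i4] [[|[|[|[|//]]]] j4] //=;
  by rewrite ?w_alt ?waf ?wag ?wfa ?wga eqxx.
have a0 := frame_nd h_sym aa bb ab ff gg af bf ag bg fg w_nd (w_alt a) waf wag wab.
by move: ab; rewrite a0 mxform0l eqxx.
Qed.

(** To reach w(f, b), of weight 1, all heavier components must vanish, but with eigenvalue 0 on [a]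
    nothing controls w(a, b) and w(a, g). Passing to the part of [w] that is odd under the
    reflection along [f] removes them and keeps w(f, .) on the complement of [f], up to a factor
    2. *)
Lemma space_eigenvalue0_split df dg cg : a *m S = 0 ->
  f *m S = df *: f -> g *m S = cg *: a + dg *: g -> df = 0.
Proof.
move=> aS fS gS; apply/eqP; apply: contraT => d0; exfalso.
have [be [ga [de [bS e1 _]]]] := null_frame_expand b (etrans aS (esym (scale0r a))).
have ga0 : ga = 0 by rewrite e1 fS mxformZr bf mulr0 mul0r.
have [w' T0' [w'_alt w'0 w'f]] := odd_part h_sym S_sym T0 fS ff.
have {}w'_alt := w'_alt w_alt.
have aS' : a *m S = 0 *: a by rewrite scale0r.
have fS' : f *m S = 0 *: a + df *: f by rewrite scale0r add0r.
rewrite !mul0r in bS.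
have L := @leading_space _ h S w' l h_sym T0' a b f g 0 df dg 0 cg be ga de
  aS' fS' gS bS aa bb ab ff gg af bf ag bg fg.
have gf : mxform h g f = 0 by rewrite h_sym.
have [wab wag wbg] : [/\ mxform w' a b = 0, mxform w' a g = 0 & mxform w' b g = 0].
  by split; apply: w'0.
have [wba wga wgb] : [/\ mxform w' b a = 0, mxform w' g a = 0 & mxform w' g b = 0].
  by split; apply: w'0.
have [] := L 3%N; [|by []|move=> /(_ isT) wfa _ _].
  by move=> [[|[|[|[|//]]]] i4] [[|[|[|[|//]]]] j4] //=; rewrite w'_alt eqxx.
have waf : mxform w' a f = 0 by rewrite (alt_skew a f w'_alt) wfa oppr0.
have [] := L 2%N; [|by []|move=> _ /(_ isT) wfg _].
  move=> [[|[|[|[|//]]]] i4] [[|[|[|[|//]]]] j4] //=;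
  by rewrite ?w'_alt ?waf ?wfa ?wag ?wga eqxx.
have wgf : mxform w' g f = 0 by rewrite (alt_skew g f w'_alt) wfg oppr0.
have [] := L 1%N; [|by []|move=> _ _ /(_ isT) wfb].
  move=> [[|[|[|[|//]]]] i4] [[|[|[|[|//]]]] j4] //=;
  by rewrite ?w'_alt ?waf ?wfa ?wag ?wga ?wab ?wba ?wfg ?wgf eqxx.
have half Y : mxform h Y f = 0 -> mxform w' f Y = 0 -> mxform w f Y = 0.
  by move=> Yf; rewrite w'f // => /eqP; rewrite mulf_eq0 pnatr_eq0 => /eqP.
have f0 := frame_nd h_sym aa bb ab ff gg af bf ag bg fg w_nd (half _ af wfa)
  (w_alt f) (half _ gf wfg) (half _ bf wfb).
by move: ff; rewrite f0 mxform0l eqxx.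
Qed.

End Frame.

(** If df is non-zero, f + (cf / df) a is an eigenvector, and a null rotation fixing [a] turns (a,
    b, f, g) into a null frame containing it, the split case. *)
Lemma space_eigenvalue0 a b f g df dg cf cg :
  mxform h a a = 0 -> mxform h b b = 0 -> mxform h a b != 0 ->
  mxform h f f != 0 -> mxform h g g != 0 -> mxform h a f = 0 -> mxform h b f = 0 ->
  mxform h a g = 0 -> mxform h b g = 0 -> mxform h f g = 0 -> a *m S = 0 ->
  f *m S = cf *: a + df *: f -> g *m S = cg *: a + dg *: g -> df = 0.
Proof.
move=> aa bb ab ff gg af bf ag bg fg aS fS gS.
apply/eqP; apply: contraT => df0; exfalso.
pose al := cf / df; pose f' := f + al *: a.
(* [x] makes b' orthogonal to f', and [y] then makes it null again. *)
pose x := - (al * mxform h a b / mxform h f f).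
pose y := - (x ^+ 2 * mxform h f f / (2 * mxform h a b)).
pose b' := b + x *: f + y *: a.
have f'f' : mxform h f' f' = mxform h f f.
  by rewrite /f' !mxformE aa (h_sym f a) af; ring.
suff : df = 0 by move/eqP: df0.
apply: (@space_eigenvalue0_split a b' f' g _ _ _ _ _ _ _ _ _ _ df dg cg) => //.
- rewrite /b' !mxformE aa bb (h_sym f b) (h_sym f a) (h_sym b a) af bf /y; field.
  by rewrite ab.
- by rewrite /b' !mxformE af aa !mulr0 !addr0.
- by rewrite f'f'.
- by rewrite /f' !mxformE af aa mulr0 addr0.
- rewrite /b' /f' !mxformE aa af (h_sym f a) (h_sym b a) af bf /x; field.
  by rewrite ff.
- by rewrite /b' !mxformE bg fg ag !mulr0 !addr0.
- by rewrite /f' !mxformE fg ag mulr0 addr0.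
- rewrite /f' mulmxDl -scalemxAl aS scaler0 addr0 fS /al scalerDr scalerA addrC.
  by congr (_ + _ *: _); field.
Qed.

(* Otherwise b -> e -> a -> 0 under S, up to nonzero factors, for an adapted frame
   (a, b', e, q), which consists of eigenvectors of gauss (b', e). *)
Lemma nilpotent_part0 a b f g cf cg :
  mxform h a a = 0 -> mxform h b b = 0 -> mxform h a b != 0 ->
  0 < mxform h f f -> 0 < mxform h g g -> mxform h a f = 0 -> mxform h b f = 0 ->
  mxform h a g = 0 -> mxform h b g = 0 -> mxform h f g = 0 -> a *m S = 0 ->
  f *m S = cf *: a -> g *m S = cg *: a -> cf = 0 /\ cg = 0.
Proof.
move=> aa bb ab fp gp af bf ag bg fg aS fS gS.
have ff := lt0r_neq0 fp; have gg := lt0r_neq0 gp.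
have [be [ga [de [bS e1 e2]]]] := null_frame_expand aa bb ab ff gg af bf ag bg fg b
  (etrans aS (esym (scale0r a))).
rewrite !mul0r scale0r addr0 in bS.
rewrite fS mxformZr (h_sym b a) in e1; rewrite gS mxformZr (h_sym b a) in e2.
pose e0 := b *m S.
(* By self-adjointness h(bS, bS) = h(b, b S^2), that is ep = th h(a, b). As a function of (ga, de),
   [ep] is positive definite, and [ga], [de] are non-zero multiples of [cf], [cg]; hence ep = 0
   already gives the claim. *)
pose th := ga * cf + de * cg; pose ep := mxform h e0 e0.
have e0S : e0 *m S = th *: a.
  by rewrite /e0 bS !mulmxDl -!scalemxAl aS fS gS scaler0 add0r !scalerA -scalerDl.
have epE : ep = ga ^+ 2 * mxform h f f + de ^+ 2 * mxform h g g.
  by rewrite /ep /e0 bS !mxformE aa fg (h_sym g f) (h_sym f a) (h_sym g a) af ag fg; ring.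
have epth : ep = th * mxform h a b by rewrite epE /th e1 e2; field; rewrite ff gg.
have [ep0|epn0] := eqVneq ep 0.
  have : 0 <= ga ^+ 2 * mxform h f f by rewrite mulr_ge0 ?sqr_ge0 // ltW.
  have : 0 <= de ^+ 2 * mxform h g g by rewrite mulr_ge0 ?sqr_ge0 // ltW.
  move=> p1 p2.
  have /eqP : ga ^+ 2 * mxform h f f = 0 by lra.
  rewrite mulf_eq0 (negbTE ff) orbF sqrf_eq0 => /eqP g0.
  have /eqP : de ^+ 2 * mxform h g g = 0 by lra.
  rewrite mulf_eq0 (negbTE gg) orbF sqrf_eq0 => /eqP d0.
  move: e1 e2; rewrite g0 d0 => /esym/eqP; rewrite !mulf_eq0 invr_eq0 (negbTE ab) (negbTE ff).
  rewrite !orbF => /eqP -> /esym/eqP; rewrite !mulf_eq0 invr_eq0 (negbTE ab) (negbTE gg).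
  by rewrite !orbF => /eqP ->.
exfalso.
(* [al] makes b' orthogonal to e = b' S, and [bt] makes b' null. *)
pose ta := mxform h e0 b; pose al := - (ta / (2 * ep)).
pose bt := - ((2 * al * ta + al ^+ 2 * ep) / (2 * mxform h a b)).
pose b' := b + al *: e0 + bt *: a; pose e := e0 + (al * th) *: a.
have ae0 : mxform h a e0 = 0 by rewrite /e0 -S_sym aS mxform0l.
have e0a : mxform h e0 a = 0 by rewrite h_sym.
have b'S : b' *m S = e by rewrite /b' !mulmxDl -!scalemxAl aS e0S scaler0 addr0 scalerA.
have eS : e *m S = th *: a by rewrite /e mulmxDl -scalemxAl aS scaler0 addr0.
have ee : mxform h e e = ep by rewrite /e !mxformE aa ae0 e0a -/ep; ring.
have ae : mxform h a e = 0 by rewrite /e !mxformE aa ae0 mulr0 addr0.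
have ab' : mxform h a b' = mxform h a b by rewrite /b' !mxformE aa ae0 !mulr0 !addr0.
have b'e : mxform h b' e = 0.
  rewrite /b' /e !mxformE aa ae0 e0a (h_sym b e0) (h_sym b a) -/ta -/ep.
  transitivity (ta + al * ep + al * (th * mxform h a b)); first by ring.
  by rewrite -epth /al; field.
have b'b' : mxform h b' b' = 0.
  rewrite /b' !mxformE aa bb ae0 e0a (h_sym b e0) (h_sym b a) -/ta -/ep /bt; field.
  by [].
have ab'0 : mxform h a b' != 0 by rewrite ab'.
clearbody b' e.
have [q q0 [aq b'q eq]] := orth3 h_sym a b' e.
have qp := spacelike h_sym P_unit P_diag aa b'b' ab'0 aq b'q q0.
have ee0 : mxform h e e != 0 by rewrite ee.
have [c0 [c1 [c2 [qS c1E c2E]]]] := null_frame_expand aa b'b' ab'0 ee0 (lt0r_neq0 qp) ae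
  b'e aq b'q eq q (etrans aS (esym (scale0r a))).
rewrite eS mxformZr (h_sym q a) aq mulr0 mul0r in c1E.
have c00 : c0 = 0.
  have : mxform h (q *m S) b' = 0 by rewrite S_sym b'S h_sym.
  rewrite qS !mxformE c1E b'b' (h_sym q b') b'q !mul0r !mulr0 !addr0 => /eqP.
  by rewrite mulf_eq0 (negbTE ab'0) orbF => /eqP.
have {c00 c1E}qS : q *m S = c2 *: q.
  by rewrite qS c00 c1E !mul0r !scale0r !add0r addr0.
(* [q] is an eigenvector and the third power of [S] vanishes, so its eigenvalue is 0. *)
have {c2E}qS : q *m S = 0.
  have [x0 [x1 [x2 [x3 qE]]]] := frame_expand h_sym aa bb ab ff gg af bf ag bg fg q.
  have : q *m S *m S *m S = 0.
    have -> : q *m S = (x1 * cf + x2 * cg) *: a + x3 *: e0.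
      by rewrite qE !mulmxDl -!scalemxAl aS fS gS scaler0 add0r !scalerA -scalerDl.
    by rewrite !mulmxDl -!scalemxAl aS e0S mul0mx -!scalemxAl aS !scaler0 addr0.
  rewrite qS -!scalemxAl qS -!scalemxAl qS !scalerA => /eqP.
  by rewrite scaler_eq0 (negbTE q0) orbF !mulf_eq0 orbb orbb => /eqP ->; rewrite scale0r.
have Db : gauss h S b' e b' = 0 *: b'.
  by rewrite /gauss (h_sym e b') b'e b'b' !scale0r subrr.
have De : gauss h S b' e e = ep *: e by rewrite /gauss b'e ee b'S scale0r subr0.
have Dq : gauss h S b' e q = 0 *: q by rewrite /gauss eq b'q !scale0r subrr.
have weX x : gauss h S b' e x = 0 *: x -> mxform w e x = 0.
  move=> Dx; apply: (@curv_eigen _ _ h S w l 0 b' e (cons2 e x (fun=> 0)) 0 ep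
    (cons2 ep 0 (fun=> 0)) T0 Db De).
    by case=> [|[|i]].
  move=> j; rewrite !big_ord_recl big_ord0 /= !addr0 add0r mulr_natl -mulrSr.
  by rewrite mulrn_eq0.
have web := weX _ Db; have weq := weX _ Dq.
(* [a] has weight -ep under rho(b', e), so w(e, a) has total weight 0 and escapes the argument used
   for [b'] and [q]. It is found in the component on (e, q, q, e), of weight 2 ep, since rho(e, q)
   sends [q] to a multiple of [a] and kills [e]. *)
have wea : mxform w e a = 0.
  have /eqP : curv h S w 1 (cons2 e q (cons2 q e (fun=> 0))) = 0.
    apply: (@curv_eigen _ _ h S w l 1 b' e (cons2 e q (cons2 q e (fun=> 0))) 0 ep
      (cons2 ep 0 (cons2 0 ep (fun=> 0))) T0 Db De); first by case=> [|[|[|[|i]]]].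
    move=> j; rewrite !big_ord_recl big_ord0 /= !addr0 !add0r.
    by rewrite mulr_natl -mulr2n -mulrnDr mulrn_eq0 addn2.
  rewrite curv_cons2 dact_cons2 /dact big_ord0 addr0 /= !curv0 /gauss qS eS.
  rewrite eq (h_sym q e) eq !scaler0 !scale0r !subr0 !mxformE addr0.
  have th0 : th != 0 by apply: contra_neq epn0 => th0; rewrite epth th0 mul0r.
  rewrite oppr_eq0 !mulf_eq0 (negbTE th0) (gt_eqF qp) /= => /eqP wae.
  by rewrite (alt_skew e a w_alt) wae oppr0.
have e00 := frame_nd h_sym aa b'b' ab'0 ee0 (lt0r_neq0 qp) ae b'e aq b'q eq w_nd
  wea (w_alt e) weq web.
by move: epn0; rewrite -ee e00 mxform0l eqxx.
Qed.

(** In a null frame whose spacelike vectors diagonalize [S] on the complement of the null plane, all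
    coefficients of [S] vanish in turn, except possibly that of b S along [a]; so the image lies on
    the line of [a]. *)
Lemma null_eigenvector a d : a != 0 -> mxform h a a = 0 -> a *m S = d *: a ->
  (\rank S <= 1)%N.
Proof.
move=> a0 aa aS.
have [b bb ab] := null_partner h_sym h_nd a0 aa.
have [f [g [fp gp [af bf ag bg] fg fSg]]] :=
  diagonal_frame h_sym P_unit P_diag S_sym aa bb ab.
have ff := lt0r_neq0 fp; have gg := lt0r_neq0 gp.
have gf : mxform h g f = 0 by rewrite h_sym.
have ex := null_frame_expand aa bb ab ff gg af bf ag bg fg _ aS.
have [cf [df [c2 [fS _ c2E]]]] := ex f.
rewrite -S_sym fSg mul0r in c2E.
rewrite c2E (h_sym f a) af mulr0 mul0r !scale0r !addr0 in fS.
have [cg [c1 [dg [gS c1E _]]]] := ex g.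
rewrite h_sym fSg mul0r in c1E.
rewrite c1E (h_sym g a) ag mulr0 mul0r !scale0r !addr0 in gS.
have d0 := null_eigenvalue0 aa bb ab ff gg af bf ag bg fg aS fS gS.
rewrite d0 scale0r in aS.
have df0 := space_eigenvalue0 aa bb ab ff gg af bf ag bg fg aS fS gS.
have dg0 := space_eigenvalue0 aa bb ab gg ff ag bg af bf gf aS gS fS.
rewrite df0 scale0r addr0 in fS; rewrite dg0 scale0r addr0 in gS.
have [cf0 cg0] := nilpotent_part0 aa bb ab fp gp af bf ag bg fg aS fS gS.
rewrite cf0 scale0r in fS; rewrite cg0 scale0r in gS.
have {ex}[be [ga [de [bS gaE deE]]]] := ex b.
rewrite fS mxform0r mul0r in gaE; rewrite gS mxform0r mul0r in deE.
rewrite d0 gaE deE !mul0r !scale0r !addr0 in bS.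
suff : (S <= a)%MS by move/mxrankS => /leq_trans -> //; apply: rank_leq_row.
apply/row_subP => i; rewrite rowE; set x : 'rV_4 := delta_mx _ _.
have [x0 [x1 [x2 [x3 ->]]]] := frame_expand h_sym aa bb ab ff gg af bf ag bg fg x.
rewrite !mulmxDl -!scalemxAl aS fS gS bS !scaler0 !add0r scalerA.
exact: scalemx_sub.
Qed.

End NullEigenvector.

(** * Orthogonal eigenbases and the pointwise rank bound *)

Section OrthogonalEigenbasis.
Variables (R : rcfType) (h S w : 'M[R]_4) (l : nat).
Hypothesis h_sym : forall X Y, mxform h X Y = mxform h Y X.
Hypothesis w_alt : forall X, mxform w X X = 0.
Hypothesis w_nd : forall X, (forall Y, mxform w X Y = 0) -> X = 0.
Hypothesis T0 : forall s, curv h S w l s = 0.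

Let orthogonal4 (u e f g : 'rV[R]_4) :=
  [/\ [/\ mxform h u u != 0, mxform h e e != 0, mxform h f f != 0 & mxform h g g != 0],
      [/\ mxform h u e = 0, mxform h u f = 0 & mxform h u g = 0] &
      [/\ mxform h e f = 0, mxform h e g = 0 & mxform h f g = 0]].

Lemma orthogonal4_unit u e f g : orthogonal4 u e f g ->
  (\matrix_i nth 0 [:: u; e; f; g] i : 'M[R]_4) \in unitmx.
Proof.
move=> [[uu ee ff gg] [ue uf ug] [ef eg fg]].
rewrite -row_free_unit; apply: inj_row_free => v; rewrite frame_lin => v0.
have E x := congr1 (mxform h x) v0.
have := E u; rewrite !mxformE ue uf ug !mulr0 !addr0 => /eqP.
rewrite mulf_eq0 (negbTE uu) orbF => /eqP vu.
have := E e; rewrite !mxformE (h_sym e u) ue ef eg !mulr0 add0r !addr0 => /eqP.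
rewrite mulf_eq0 (negbTE ee) orbF => /eqP ve.
have := E f; rewrite !mxformE (h_sym f u) (h_sym f e) uf ef fg !mulr0 !add0r addr0.
move=> /eqP; rewrite mulf_eq0 (negbTE ff) orbF => /eqP vf.
have := E g; rewrite !mxformE (h_sym g u) (h_sym g e) (h_sym g f) ug eg fg !mulr0 !add0r.
move=> /eqP; rewrite mulf_eq0 (negbTE gg) orbF => /eqP vg.
apply/rowP => -[[|[|[|[|//]]]] i4]; rewrite [RHS]mxE.
- by rewrite -[RHS]vu; congr (v 0 _); apply: val_inj; rewrite /= inordK.
- by rewrite -[RHS]ve; congr (v 0 _); apply: val_inj; rewrite /= inordK.
- by rewrite -[RHS]vf; congr (v 0 _); apply: val_inj; rewrite /= inordK.
- by rewrite -[RHS]vg; congr (v 0 _); apply: val_inj; rewrite /= inordK.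
Qed.

Lemma orthogonal4_eigenvalue0 u e f g du de df dg : orthogonal4 u e f g ->
  u *m S = du *: u -> e *m S = de *: e -> f *m S = df *: f -> g *m S = dg *: g ->
  du = 0.
Proof.
move=> o4; have U := orthogonal4_unit o4.
move: o4 => [[uu ee ff gg] [ue uf ug] [ef eg fg]] uS eS fS gS.
apply/eqP; apply: contraT => du0; exfalso.
have sw X Y : mxform h X Y = 0 -> mxform h Y X = 0 by rewrite h_sym.
have we : mxform w u e = 0.
  by apply: (diag_orth h_sym T0 uS fS gS) => //; apply: sw.
have wf : mxform w u f = 0.
  by apply: (diag_orth h_sym T0 uS eS gS) => //; apply: sw.
have wg : mxform w u g = 0.
  by apply: (diag_orth h_sym T0 uS eS fS) => //; apply: sw.
have u0 : u = 0.
  apply: w_nd => y; rewrite -(mulmxKV U y) frame_lin !mxformE w_alt we wf wg.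
  by rewrite !mulr0 !addr0.
by move: uu; rewrite u0 mxform0l eqxx.
Qed.

Lemma orthogonal4_eigenbasis u e f g du de df dg : orthogonal4 u e f g ->
  u *m S = du *: u -> e *m S = de *: e -> f *m S = df *: f -> g *m S = dg *: g ->
  S = 0.
Proof.
move=> o4 uS eS fS gS; have U := orthogonal4_unit o4.
have sw X Y : mxform h X Y = 0 -> mxform h Y X = 0 by rewrite h_sym.
have du0 := orthogonal4_eigenvalue0 o4 uS eS fS gS.
move: o4 => [[uu ee ff gg] [ue uf ug] [ef eg fg]].
have de0 : de = 0.
  apply: (orthogonal4_eigenvalue0 _ eS uS fS gS).
  by split; split=> //; apply: sw.
have df0 : df = 0.
  apply: (orthogonal4_eigenvalue0 _ fS uS eS gS).
  by split; split=> //; apply: sw.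
have dg0 : dg = 0.
  apply: (orthogonal4_eigenvalue0 _ gS uS eS fS).
  by split; split=> //; apply: sw.
apply: (can_inj (mulKmx U)); rewrite mulmx0; apply/row_matrixP => i.
rewrite row_mul rowK row0.
by case: i => -[|[|[|[|//]]]] i4 /=; rewrite ?uS ?eS ?fS ?gS ?du0 ?de0 ?df0 ?dg0 scale0r.
Qed.

End OrthogonalEigenbasis.

(** If the rank exceeds 1, no eigenvector is null. The complement of the eigenvectors found so far
    is invariant by self-adjointness and contains an eigenvector, whose eigenvalue is real; being
    non-null, it splits off, and four rounds give an orthogonal eigenbasis. *)
Theorem curv_rank (R : rcfType) (h S w : 'M[R]_4) (P : 'M[R]_(3 + 1)) (l : nat) :
  (forall X Y, mxform h X Y = mxform h Y X) ->
  (forall X, (forall Y, mxform h X Y = 0) -> X = 0) ->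
  P \in unitmx -> P *m (h : 'M[R]_(3 + 1)) *m P^T = block_mx 1%:M 0 0 (- 1%:M) ->
  (forall X Y, mxform h (X *m S) Y = mxform h X (Y *m S)) ->
  (forall X, mxform w X X = 0) ->
  (forall X, (forall Y, mxform w X Y = 0) -> X = 0) ->
  (forall s, curv h S w l s = 0) -> (\rank S <= 1)%N.
Proof.
move=> h_sym h_nd P_unit P_diag S_sym w_alt w_nd T0.
have real (a b : 'rV[R]_4) la mu : a != 0 \/ b != 0 -> a *m S = la *: a - mu *: b ->
    b *m S = mu *: a + la *: b -> mu = 0.
  move=> ab0 aS bS; apply/eqP; apply: contraT => mu0; exfalso.
  (* A complex eigenvector and its conjugate belong to different eigenvalues, hence are orthogonal
     for the bilinear extension of [h]. *)
  have trace0 : mxform h b b = - mxform h a a.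
    have := S_sym a b; rewrite aS bS !mxformE => e.
    have /eqP : mu * (mxform h a a + mxform h b b) = 0 by lra.
    by rewrite mulf_eq0 (negbTE mu0) addrC addr_eq0 => /eqP.
  pose p := mxform h a a; pose q := mxform h a b.
  (* Multiplying a + i b by x + i y gives a' + i b', still an eigenvector. The equation says that
     h(a', a') = 0, and then h(b', b') = 0 as well. *)
  have [x [y [xy0 xyE]]] : exists x y : R,
      (0 < x ^+ 2 + y ^+ 2) /\ x ^+ 2 * p - 2 * x * y * q - y ^+ 2 * p = 0.
    have [p0|p0] := eqVneq p 0.
      by exists 1, 0; rewrite p0; split; [lra|ring].
    have D0 : 0 <= q ^+ 2 + p ^+ 2 by rewrite addr_ge0 ?sqr_ge0.
    exists (q + Num.sqrt (q ^+ 2 + p ^+ 2)), p; split.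
      by rewrite ltr_wpDl ?sqr_ge0 // exprn_even_gt0.
    have := sqr_sqrtr D0; set r := Num.sqrt _ => r2.
    transitivity (p * (r ^+ 2 - q ^+ 2 - p ^+ 2)); first by ring.
    by rewrite r2; ring.
  pose a' := x *: a - y *: b; pose b' := y *: a + x *: b.
  have a'S : a' *m S = la *: a' - mu *: b'.
    by rewrite mulmxBl -!scalemxAl aS bS; apply/rowP => j; rewrite !mxE; ring.
  have b'S : b' *m S = mu *: a' + la *: b'.
    by rewrite mulmxDl -!scalemxAl aS bS; apply/rowP => j; rewrite !mxE; ring.
  have a'a' : mxform h a' a' = 0.
    by rewrite /a' !mxformE trace0 (h_sym b a) -/p -/q -[RHS]xyE; ring.
  have b'b' : mxform h b' b' = 0.
    rewrite /b' !mxformE trace0 (h_sym b a) -/p -/q.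
    by rewrite -[RHS]oppr0 -[in RHS]xyE; ring.
  have [a'b'|a'b'] := eqVneq (mxform h a' b') 0; last first.
    by move/eqP: mu0; apply; apply: (complex_plane h_sym P_unit P_diag S_sym w_alt w_nd
      T0 a'a' b'b' a'b' a'S b'S).
  have a'0 : a' != 0.
    apply/negP => /eqP a'0.
    have b'0 : b' = 0.
      move: a'S; rewrite a'0 mul0mx scaler0 sub0r => /eqP.
      by rewrite eq_sym oppr_eq0 scaler_eq0 (negbTE mu0) => /eqP.
    have ea : (x ^+ 2 + y ^+ 2) *: a = x *: a' + y *: b'.
      by rewrite /a' /b'; apply/rowP => j; rewrite !mxE; ring.
    have eb : (x ^+ 2 + y ^+ 2) *: b = x *: b' - y *: a'.
      by rewrite /a' /b'; apply/rowP => j; rewrite !mxE; ring.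
    move: ea eb; rewrite a'0 b'0 !scaler0 addr0 subr0 => /eqP + /eqP.
    rewrite !scaler_eq0 (gt_eqF xy0) /= => /eqP ea /eqP eb.
    by case: ab0; rewrite ?ea ?eb eqxx.
  (* Orthogonal null vectors are proportional, so a' would be a real eigenvector, contradicting mu
     != 0. *)
  case: (causal P_unit P_diag a'0 a'a' a'b') => [|[c b'E]].
    by rewrite b'b' ltxx.
  have : (mu * (1 + c ^+ 2)) *: a' = 0.
    have : b' *m S = c *: (a' *m S) by rewrite b'E -scalemxAl.
    rewrite a'S b'S b'E => /rowP e; apply/rowP => j; have := e j.
    by rewrite !mxE; lra.
  move/eqP; rewrite scaler_eq0 (negbTE a'0) mulf_eq0 (negbTE mu0) !orbF /=.
  by rewrite gt_eqF // ltr_wpDr ?sqr_ge0.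
apply: contraT => rank2; exfalso.
have nonnull (a : 'rV[R]_4) d : a != 0 -> a *m S = d *: a -> mxform h a a != 0.
  move=> a0 aS; apply/negP => /eqP aa; move/negP: rank2; apply.
  exact: (null_eigenvector h_sym h_nd P_unit P_diag S_sym w_alt w_nd T0 a0 aa aS).
have next (X Y Z : 'rV[R]_4) dX dY dZ : X *m S = dX *: X -> Y *m S = dY *: Y -> Z *m S = dZ *: Z ->
    exists (v : 'rV[R]_4) d, [/\ v *m S = d *: v, mxform h v v != 0, mxform h X v = 0,
      mxform h Y v = 0 & mxform h Z v = 0].
  move=> XS YS ZS; pose A := h *m (col_mx X (col_mx Y Z))^T.
  have inW v : (v <= kermx A)%MS <->
      [/\ mxform h X v = 0, mxform h Y v = 0 & mxform h Z v = 0].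
    have e U : (v *m h *m U^T == 0) = (mxform h U v == 0).
      rewrite h_sym /mxform; apply/eqP/eqP => [->|E]; first by rewrite mxE.
      by apply/matrixP => i j; rewrite !ord1 E mxE.
    rewrite (sameP sub_kermxP eqP) /A !tr_col_mx mulmxA !mul_mx_row !row_mx_eq0 !e.
    by split=> [/and3P[/eqP -> /eqP -> /eqP ->]|[-> -> ->]]; rewrite ?eqxx.
  have W0 : kermx A != 0.
    rewrite -mxrank_eq0 mxrank_ker subn_eq0 -ltnNge ltnS.
    exact: (leq_trans (rank_leq_col _)).
  have WS : (kermx A *m S <= kermx A)%MS.
    apply/row_subP => i; rewrite row_mul; apply/inW.
    have /inW[Xi Yi Zi] := row_sub i (kermx A).
    by rewrite -!S_sym XS YS ZS !mxformE Xi Yi Zi !mulr0.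
  have [a [b [la [mu [ab0 /inW aW /inW bW aS bS]]]]] := complex_eigenvector W0 WS.
  have mu0 := real a b la mu ab0 aS bS.
  rewrite mu0 !scale0r subr0 add0r in aS bS.
  case: ab0 => [a0|b0].
    by exists a, la; case: aW => ? ? ?; split=> //; apply: nonnull a0 aS.
  by exists b, la; case: bW => ? ? ?; split=> //; apply: nonnull b0 bS.
(* [next] takes three eigenvectors; missing ones are filled by 0 or by repetition. *)
have z0 : (0 : 'rV[R]_4) *m S = 0 *: 0 by rewrite mul0mx scaler0.
have [u [du [uS uu _ _ _]]] := next _ _ _ _ _ _ z0 z0 z0.
have [e [de [eS ee ue _ _]]] := next _ _ _ _ _ _ uS uS uS.
have [f [df [fS ff uf ef _]]] := next _ _ _ _ _ _ uS eS eS.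
have [g [dg [gS gg ug eg fg]]] := next _ _ _ _ _ _ uS eS fS.
have S0 : S = 0.
  by apply: (orthogonal4_eigenbasis h_sym w_alt w_nd T0 _ uS eS fS gS).
by move: rank2; rewrite S0 mxrank0.
Qed.

(** * Smooth functions *)

Section Differentiability.
Variables (R : realType) (V W : normedModType R).

Lemma near_eq_differentiable (f g : V -> W) x :
  (\near x, f x = g x) -> differentiable f x -> differentiable g x.
Proof.
move=> fg /[dup] df /diff_locallyP[dc e].
have H : g \o shift x = cst (g x) + 'd f x +o_ 0 id.
  apply/eqaddoP => eps eps0; move/eqaddoP: e => /(_ eps eps0).
  have fg0 : \forall z \near 0, f (z + x) = g (z + x).
    rewrite (near_shift x) /=.
    by apply: filterS fg => z /=; rewrite sub0r subrK.
  apply: filter_app; near=> z => /=.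
  have E : f (z + x) = g (z + x) by near: z.
  by rewrite !fctE /= E (nbhs_singleton fg).
by apply/diff_locallyP; rewrite (diff_unique dc H).
Unshelve. all: by end_near. Qed.

End Differentiability.

Section Smooth.
Variables (R : realType) (V : normedModType R) (U : set V).
Hypothesis U_open : open U.

Lemma near_open x : U x -> \forall y \near x, U y.
Proof. by move=> Ux; apply: open_nbhs_nbhs. Qed.

Lemma eq_on_near (W : Type) (f g : V -> W) x : (forall y, U y -> f y = g y) -> U x ->
  \near x, f x = g x.
Proof. by move=> fg Ux; near=> y; apply: fg; near: y; apply: near_open. Unshelve. all: by end_near. Qed.

Lemma derive_eq_on (W : normedModType R) (f g : V -> W) x v :
  (forall y, U y -> f y = g y) -> U x -> 'D_v f x = 'D_v g x.
Proof. by move=> fg Ux; apply: near_eq_derive; apply: eq_on_near. Qed.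

Lemma Ck_on_eq (W : normedModType R) k (f g : V -> W) :
  (forall y, U y -> f y = g y) -> Ck_on k U f -> Ck_on k U g.
Proof.
elim: k f g => [|k IH] f g fg /=.
  move=> cf x Ux; have := cf x Ux.
  rewrite /prop_for /continuous_at -(fg x Ux); apply: cvg_trans.
  by apply: near_eq_cvg; apply: eq_on_near.
move=> [df Cf]; split=> [x Ux|v].
  by apply: (near_eq_differentiable (eq_on_near fg Ux)); apply: df.
by apply: IH (Cf v) => y Uy; apply: derive_eq_on.
Qed.

Section Module.
Variable W : normedModType R.
Implicit Types f g : V -> W.

Lemma smooth_on_eq f g : (forall y, U y -> f y = g y) ->
  smooth_on U f -> smooth_on U g.
Proof. by move=> fg sf k; apply: Ck_on_eq fg (sf k). Qed.

Lemma smooth_differentiable f x : smooth_on U f -> U x -> differentiable f x.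
Proof. by move=> /(_ 1%N)[+ _] => /[apply]. Qed.

Lemma smooth_derivable f x v : smooth_on U f -> U x -> derivable f x v.
Proof. by move=> sf Ux; apply: diff_derivable; apply: smooth_differentiable. Qed.

Lemma smooth_continuous f x : smooth_on U f -> U x -> {for x, continuous f}.
Proof. by move=> /(_ 0%N); apply. Qed.

Lemma smooth_derive f v : smooth_on U f -> smooth_on U ('D_v f).
Proof. by move=> sf k; apply: (sf k.+1).2. Qed.

Lemma smooth_cst (c : W) : smooth_on U (fun=> c).
Proof.
move=> k; elim: k c => [|k IH] c /=; first by move=> x _; apply: cvg_cst.
split=> [x _|v]; first exact: differentiable_cst.
by apply: Ck_on_eq (IH 0) => y _; rewrite derive_cst.
Qed.

Lemma Ck_onD k f g : Ck_on k U f -> Ck_on k U g -> Ck_on k U (fun x => f x + g x).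
Proof.
elim: k f g => [|k IH] f g /=.
  by move=> cf cg x Ux; apply: cvgD; [apply: cf|apply: cg].
move=> [df Cf] [dg Cg]; split=> [x Ux|v].
  by apply: differentiableD; [apply: df|apply: dg].
apply: (Ck_on_eq _ (IH _ _ (Cf v) (Cg v))) => y Uy.
by rewrite [RHS]deriveD //; apply: diff_derivable; [apply: df|apply: dg].
Qed.

Lemma smoothD f g : smooth_on U f -> smooth_on U g ->
  smooth_on U (fun x => f x + g x).
Proof. by move=> sf sg k; apply: Ck_onD. Qed.

Lemma smooth_sum (I : Type) (r : seq I) (P : pred I) (F : I -> V -> W) :
  (forall i, P i -> smooth_on U (F i)) -> smooth_on U (fun x => \sum_(i <- r | P i) F i x).
Proof.
move=> sF; elim: r => [|i r IH].
  by apply: smooth_on_eq (smooth_cst 0) => y _; rewrite big_nil.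
case Pi : (P i).
  apply: smooth_on_eq (smoothD (sF i Pi) IH) => y _; by rewrite big_cons Pi.
by apply: smooth_on_eq IH => y _; rewrite big_cons Pi.
Qed.

End Module.

Lemma smoothM (f g : V -> R) : smooth_on U f -> smooth_on U g ->
  smooth_on U (fun x => f x * g x).
Proof.
move=> sf sg k; elim: k f g sf sg => [|k IH] f g sf sg.
  by move=> x Ux; apply: cvgM; apply: smooth_continuous.
split=> [x Ux|v].
  by apply: differentiableM; apply: smooth_differentiable.
have E y : U y -> 'D_v f y * g y + f y * 'D_v g y = 'D_v (fun x => f x * g x) y.
  move=> Uy; rewrite [RHS]deriveM; [|exact: smooth_derivable..].
  by rewrite addrC /GRing.scale /= [g y * _]mulrC.
apply: (Ck_on_eq E); apply: Ck_onD; apply: IH => //; exact: smooth_derive.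
Qed.

Lemma derive_coord m n (M : V -> 'M[R]_(m, n)) x v i j : derivable M x v ->
  'D_v (fun y => M y i j) x = 'D_v M x i j.
Proof. by move=> dM; rewrite derive_mx // mxE. Qed.

Lemma smooth_coord m n (M : V -> 'M[R]_(m, n)) i j :
  smooth_on U M -> smooth_on U (fun y => M y i j).
Proof.
move=> sM k; elim: k M sM => [|k IH] M sM.
  move=> x Ux; apply: differentiable_continuous.
  apply: (@differentiable_comp _ _ _ _ M (fun N : 'M[R]_(m, n) => N i j)).
    exact: smooth_differentiable.
  exact: differentiable_coord.
split=> [x Ux|v].
  apply: (@differentiable_comp _ _ _ _ M (fun N : 'M[R]_(m, n) => N i j)).
    exact: smooth_differentiable.
  exact: differentiable_coord.
apply: (Ck_on_eq _ (IH _ (smooth_derive v sM))) => y Uy.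
by rewrite derive_coord //; apply: smooth_derivable.
Qed.

Lemma derive_scalel (W : normedModType R) (f : V -> R) (c : W) x v :
  differentiable f x -> 'D_v (fun y => f y *: c) x = 'D_v f x *: c.
Proof.
move=> df; rewrite deriveE; last exact: differentiableZl.
by rewrite diffZl // deriveE.
Qed.

Lemma smooth_scalel (W : normedModType R) (f : V -> R) (c : W) :
  smooth_on U f -> smooth_on U (fun y => f y *: c).
Proof.
move=> sf k; elim: k f sf => [|k IH] f sf.
  move=> x Ux; apply: differentiable_continuous; apply: differentiableZl.
  exact: smooth_differentiable.
split=> [x Ux|v]; first by apply: differentiableZl; apply: smooth_differentiable.
apply: (Ck_on_eq _ (IH _ (smooth_derive v sf))) => y Uy.
by rewrite derive_scalel //; apply: smooth_differentiable.
Qed.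

Lemma smooth_rowP n (g : V -> 'rV[R]_n) :
  (forall j, smooth_on U (fun y => g y 0 j)) -> smooth_on U g.
Proof.
move=> sg.
apply: (@smooth_on_eq _ (fun y => \sum_j g y 0 j *: delta_mx 0 j)) => [y _|].
  by rewrite -row_sum_delta.
by apply: smooth_sum => j _; apply: smooth_scalel.
Qed.

Section Schwarz.
Variable g : V -> R.
Hypothesis sg : smooth_on U g.

Lemma is_derive_line (k : V -> R) y u (t : R) : derivable k (y + t *: u) u ->
  is_derive t 1 (fun s : R => k (y + s *: u)) ('D_u k (y + t *: u)).
Proof.
have E : (fun h : R => h^-1 *: (((fun s : R => k (y + s *: u)) \o shift t) (h *: 1) -
      k (y + t *: u))) =
    (fun h : R => h^-1 *: ((k \o shift (y + t *: u)) (h *: u) - k (y + t *: u))).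
  apply: funext => h /=; congr (_ *: (k _ - _)).
  by rewrite scalerDl addrCA [h%:A]mulr1.
by move=> dk; split; rewrite /derivable /derive E.
Qed.

(** The mean value theorem is applied along [u] to the difference of [g] on two parallel segments,
    and then along [v] to the resulting derivative. *)
Lemma second_difference x u v s : 0 < s ->
  (forall a b, 0 <= a <= s -> 0 <= b <= s -> U (x + a *: u + b *: v)) ->
  exists a b, [/\ 0 <= a <= s, 0 <= b <= s &
    g (x + s *: u + s *: v) - g (x + s *: u) - g (x + s *: v) + g x =
    s ^+ 2 * 'D_v ('D_u g) (x + a *: u + b *: v)].
Proof.
move=> s0 Us.
pose F (t : R) := g (x + s *: v + t *: u) - g (x + t *: u).
have Uv t : 0 <= t <= s -> U (x + s *: v + t *: u).
  by move=> ts; rewrite addrAC; apply: Us => //; rewrite lexx ltW.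
have U0 t : 0 <= t <= s -> U (x + t *: u).
  by move=> ts; rewrite -[_ + _]addr0 -(scale0r v); apply: Us; rewrite // lexx ltW.
have dF t : 0 <= t <= s ->
    is_derive t 1 F ('D_u g (x + s *: v + t *: u) - 'D_u g (x + t *: u)).
  move=> ts; apply: is_deriveB; apply: is_derive_line; apply: smooth_derivable sg _.
    exact: Uv.
  exact: U0.
have cF : {within `[0, s], continuous F}.
  by apply: derivable_within_continuous => t; rewrite in_itv /= => /dF[].
have dF' t : t \in `]0, s[ -> is_derive t 1 F
    ('D_u g (x + s *: v + t *: u) - 'D_u g (x + t *: u)).
  by rewrite in_itv /= => /andP[t0 ts]; apply: dF; rewrite !ltW.
have [a + FE] := MVT s0 dF' cF; rewrite in_itv /= => /andP[/ltW a0 /ltW as_].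
have a0s : 0 <= a <= s by rewrite a0.
pose G (t : R) := 'D_u g (x + a *: u + t *: v).
have dG t : 0 <= t <= s -> is_derive t 1 G ('D_v ('D_u g) (x + a *: u + t *: v)).
  move=> ts; apply: is_derive_line; apply: smooth_derivable (smooth_derive u sg) _.
  exact: Us.
have cG : {within `[0, s], continuous G}.
  by apply: derivable_within_continuous => t; rewrite in_itv /= => /dG[].
have dG' t : t \in `]0, s[ -> is_derive t 1 G ('D_v ('D_u g) (x + a *: u + t *: v)).
  by rewrite in_itv /= => /andP[t0 ts]; apply: dG; rewrite !ltW.
have [b + GE] := MVT s0 dG' cG; rewrite in_itv /= => /andP[/ltW b0 /ltW bs].
exists a, b; split=> //; first by rewrite b0.
move: FE GE; rewrite /F /G !subr0 !scale0r !addr0 -(addrAC x (a *: u)) => FE GE.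
rewrite (addrAC x (s *: u)).
transitivity (g (x + s *: v + s *: u) - g (x + s *: u) - (g (x + s *: v) - g x)).
  by ring.
by rewrite FE GE; ring.
Qed.

(** The second difference is symmetric in [u] and [v], so each mixed derivative takes a common value
    at some point near [x]; continuity excludes a gap between them at [x]. *)
Lemma schwarz x u v : U x -> 'D_u ('D_v g) x = 'D_v ('D_u g) x.
Proof.
move=> Ux; apply/eqP; apply: contraT => AB; exfalso.
set A := 'D_u _ x in AB; set B := 'D_v _ x in AB.
pose e := `|A - B|; have e0 : 0 < e by rewrite normr_gt0 subr_eq0.
have e2 : 0 < e / 2 by rewrite divr_gt0.
have cA := smooth_continuous (smooth_derive u (smooth_derive v sg)) Ux.
have cB := smooth_continuous (smooth_derive v (smooth_derive u sg)) Ux.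
have N : \forall y \near x, [/\ U y, `|A - 'D_u ('D_v g) y| < e / 2 &
    `|B - 'D_v ('D_u g) y| < e / 2].
  have NA : \forall y \near x, `|A - 'D_u ('D_v g) y| < e / 2.
    by move/cvgrPdist_lt: cA; apply.
  have NB : \forall y \near x, `|B - 'D_v ('D_u g) y| < e / 2.
    by move/cvgrPdist_lt: cB; apply.
  by apply: filterS3 (near_open Ux) NA NB => y.
have [d /= d0 Nd] := (nbhs_ballP _ _).1 N.
(* The summand 1 keeps the denominator positive and makes the distance bound strict. *)
pose s := d / (`|u| + `|v| + 1).
have uv0 : 0 < `|u| + `|v| + 1 by rewrite ltr_wpDl ?addr_ge0.
have s0 : 0 < s by rewrite divr_gt0.
have near_s (a b : R) (u' v' : V) : `|u'| + `|v'| = `|u| + `|v| ->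
    0 <= a <= s -> 0 <= b <= s -> ball x d (x + a *: u' + b *: v').
  move=> uv /andP[a0 as_] /andP[b0 bs].
  rewrite -ball_normE /= -addrA opprD addNKr -normrN opprK.
  apply: (le_lt_trans (ler_normD _ _)); rewrite !normrZ !ger0_norm //.
  apply: (@le_lt_trans _ _ (s * (`|u| + `|v|))).
    by rewrite -uv mulrDr lerD // ler_wpM2r.
  by rewrite /s mulrAC ltr_pdivrMr // ltr_pM2l // ltrDl.
have [a [b [as_ bs E1]]] : exists a b, [/\ 0 <= a <= s, 0 <= b <= s &
    g (x + s *: u + s *: v) - g (x + s *: u) - g (x + s *: v) + g x =
    s ^+ 2 * 'D_v ('D_u g) (x + a *: u + b *: v)].
  by apply: second_difference => // a b a_ b_; case: (Nd _ (near_s a b u v erefl a_ b_)).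
have [a' [b' [as' bs' E2]]] : exists a b, [/\ 0 <= a <= s, 0 <= b <= s &
    g (x + s *: v + s *: u) - g (x + s *: v) - g (x + s *: u) + g x =
    s ^+ 2 * 'D_u ('D_v g) (x + a *: v + b *: u)].
  apply: second_difference => // c c' c_ c'_.
  by case: (Nd _ (near_s c c' v u (addrC _ _) c_ c'_)).
have [_ _ nB] := Nd _ (near_s a b u v erefl as_ bs).
have [_ nA _] := Nd _ (near_s a' b' v u (addrC _ _) as' bs').
have E : 'D_v ('D_u g) (x + a *: u + b *: v) = 'D_u ('D_v g) (x + a' *: v + b' *: u).
  apply: (mulfI (lt0r_neq0 (exprn_gt0 2 s0))); rewrite -E1 -E2 (addrAC x).
  by congr (_ + _); rewrite [LHS]addrAC.
have : `|A - B| < e / 2 + e / 2.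
  rewrite -(subrKA ('D_v ('D_u g) (x + a *: u + b *: v))).
  apply: le_lt_trans (ler_normD _ _) _; apply: ltrD; first by rewrite E; exact: nA.
  by rewrite distrC; exact: nB.
by rewrite -splitr ltxx.
Qed.

End Schwarz.
End Smooth.

(** * Covariant derivatives in a chart *)

Section SmoothRows.
Variables (R : realType) (n : nat).
Local Notation E := 'rV[R]_n.
Variable U : set E.
Hypothesis U_open : open U.

Lemma derive_linear (W : normedModType R) (f : E -> W) x a u v : differentiable f x ->
  'D_(a *: u + v) f x = a *: 'D_u f x + 'D_v f x.
Proof. by move=> df; rewrite !deriveE // linearP. Qed.

Lemma derive_sum_seq (I : Type) (r : seq I) (F : I -> E -> R) x v :
  (forall i, smooth_on U (F i)) -> U x ->
  'D_v (fun y => \sum_(i <- r) F i y) x = \sum_(i <- r) 'D_v (F i) x.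
Proof.
move=> sF Ux; elim: r => [|i r IH].
  rewrite big_nil (_ : (fun _ => _) = cst 0) ?derive_cst //.
  by apply: funext => y; rewrite big_nil.
rewrite big_cons -IH -[RHS]deriveD; last 2 first.
- exact: smooth_derivable (sF i) Ux.
- by apply: smooth_derivable _ Ux; apply: smooth_sum.
by congr ('D_v _ x); apply: funext => y; rewrite big_cons.
Qed.

Lemma derive_mul (f g : E -> R) x v : smooth_on U f -> smooth_on U g -> U x ->
  'D_v (fun y => f y * g y) x = 'D_v f x * g x + f x * 'D_v g x.
Proof.
move=> sf sg Ux; rewrite [LHS]deriveM; [|exact: smooth_derivable _ Ux..].
by rewrite addrC /GRing.scale /= [g x * _]mulrC.
Qed.

Lemma derive_scale m (f : E -> R) (g : E -> 'rV[R]_m) x v :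
  smooth_on U f -> smooth_on U g -> U x ->
  'D_v (fun y => f y *: g y) x = 'D_v f x *: g x + f x *: 'D_v g x.
Proof.
move=> sf sg Ux; apply/rowP => j.
have sc := smooth_coord U_open 0 j sg.
have sfg : smooth_on U (fun y => f y *: g y).
  apply: smooth_rowP => // i.
  apply: (smooth_on_eq U_open _ (smoothM U_open sf (smooth_coord U_open 0 i sg))) => y _.
  by rewrite mxE.
rewrite -derive_coord; last exact: smooth_derivable _ Ux.
rewrite !mxE -(derive_coord _ _ (smooth_derivable sg Ux)) -derive_mul //.
by congr ('D_v _ x); apply: funext => y; rewrite mxE.
Qed.

Lemma schwarz_row m (g : E -> 'rV[R]_m) x u v : smooth_on U g -> U x ->
  'D_u ('D_v g) x = 'D_v ('D_u g) x.
Proof.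
move=> sg Ux; apply/rowP => j.
have e a b : 'D_a ('D_b g) x 0 j = 'D_a ('D_b (fun y => g y 0 j)) x.
  rewrite -derive_coord; last exact: smooth_derivable (smooth_derive _ sg) Ux.
  apply: (derive_eq_on U_open) Ux => y Uy; rewrite derive_coord //.
  exact: smooth_derivable _ Uy.
have sc := smooth_coord U_open 0 j sg.
have es := schwarz U_open sc u v Ux.
exact: etrans (e u v) (etrans es (esym (e v u))).
Qed.

Lemma smooth_row_sum (I : Type) (r : seq I) (f : I -> E -> R) m (c : I -> 'rV[R]_m) :
  (forall i, smooth_on U (f i)) -> smooth_on U (fun y => \sum_(i <- r) f i y *: c i).
Proof. by move=> sf; apply: smooth_sum => // i _; apply: smooth_scalel. Qed.

End SmoothRows.

Section LocalConnection.
Variables (R : realType) (n : nat).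
Local Notation E := 'rV[R]_n.
Local Notation e_ i := (delta_mx 0 i : E).
Variable U : set E.
Hypothesis U_open : open U.
Variable N : (E -> E) -> (E -> E) -> (E -> E).
Hypothesis N_smooth : forall X Y, smooth_on U X -> smooth_on U Y -> smooth_on U (N X Y).
Hypothesis N_linear : forall (a : E -> R) X X' Y, smooth_on U a -> smooth_on U X ->
  smooth_on U X' -> smooth_on U Y -> forall x, U x ->
  N (fun y => a y *: X y + X' y) Y x = a x *: N X Y x + N X' Y x.
Hypothesis N_leibniz : forall (a : E -> R) X Y Y', smooth_on U a -> smooth_on U X ->
  smooth_on U Y -> smooth_on U Y' -> forall x, U x ->
  N X (fun y => a y *: Y y + Y' y) x =
  'D_(X x) a x *: Y x + a x *: N X Y x + N X Y' x.

(** The Christoffel symbols, as a bilinear map on constant vectors. *)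
Definition Gam (u v : E) (y : E) : E :=
  \sum_i \sum_j (u 0 i * v 0 j) *: N (fun=> e_ i) (fun=> e_ j) y.

Lemma Gam_linl a u u' v y : Gam (a *: u + u') v y = a *: Gam u v y + Gam u' v y.
Proof.
rewrite scaler_sumr -big_split; apply: eq_bigr => i _ /=.
rewrite scaler_sumr -big_split; apply: eq_bigr => j _ /=.
by rewrite !mxE mulrDl scalerDl scalerA mulrA.
Qed.

Lemma Gam_linr a u v v' y : Gam u (a *: v + v') y = a *: Gam u v y + Gam u v' y.
Proof.
rewrite scaler_sumr -big_split; apply: eq_bigr => i _ /=.
rewrite scaler_sumr -big_split; apply: eq_bigr => j _ /=.
by rewrite !mxE mulrDr scalerDl scalerA mulrCA.
Qed.

Lemma Gam_smooth u v : smooth_on U (Gam u v).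
Proof.
apply: smooth_sum => // i _; apply: smooth_sum => // j _.
apply: smooth_rowP => // m.
have sN : smooth_on U (N (fun=> e_ i) (fun=> e_ j)).
  by apply: N_smooth; apply: smooth_cst.
apply: (smooth_on_eq U_open _ (smoothM U_open (smooth_cst U_open (u 0 i * v 0 j))
  (smooth_coord U_open 0 m sN))) => y _.
by rewrite mxE.
Qed.

Lemma N_suml (I : Type) (r : seq I) (a : I -> E -> R) (c : I -> E) Y x :
  (forall i, smooth_on U (a i)) -> smooth_on U Y -> U x ->
  N (fun y => \sum_(i <- r) a i y *: c i) Y x = \sum_(i <- r) a i x *: N (fun=> c i) Y x.
Proof.
move=> sa sY Ux; elim: r => [|i r IH].
  rewrite big_nil.
  have f0 : (fun y : E => (fun=> 1 : R) y *: (fun=> 0 : E) y + (fun=> 0 : E) y) = (fun=> 0).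
    by apply: funext => y; rewrite scaler0 addr0.
  have := N_linear (smooth_cst U_open (1 : R)) (smooth_cst U_open (0 : E))
    (smooth_cst U_open (0 : E)) sY Ux.
  rewrite f0 scale1r => /eqP; rewrite -subr_eq0 opprD addrA subrr sub0r oppr_eq0 => /eqP N0.
  by rewrite -[RHS]N0; congr N; apply: funext => y; rewrite big_nil.
rewrite big_cons -IH -N_linear //; last 2 first.
- exact: smooth_cst.
- exact: smooth_row_sum.
by congr N; apply: funext => y; rewrite big_cons.
Qed.

Lemma N_sumr (I : Type) (r : seq I) (a : I -> E -> R) (c : I -> E) X x :
  (forall i, smooth_on U (a i)) -> smooth_on U X -> U x ->
  N X (fun y => \sum_(i <- r) a i y *: c i) x =
  \sum_(i <- r) ('D_(X x) (a i) x *: c i + a i x *: N X (fun=> c i) x).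
Proof.
move=> sa sX Ux; elim: r => [|i r IH].
  rewrite big_nil.
  have f0 : (fun y : E => (fun=> 1 : R) y *: (fun=> 0 : E) y + (fun=> 0 : E) y) = (fun=> 0).
    by apply: funext => y; rewrite scaler0 addr0.
  have := N_leibniz (smooth_cst U_open (1 : R)) sX
    (smooth_cst U_open (0 : E)) (smooth_cst U_open (0 : E)) Ux.
  rewrite f0 scaler0 add0r scale1r => /eqP.
  rewrite -subr_eq0 opprD addrA subrr sub0r oppr_eq0 => /eqP N0.
  by rewrite -[RHS]N0; congr N; apply: funext => y; rewrite big_nil.
rewrite big_cons -IH -N_leibniz //; last 2 first.
- exact: smooth_cst.
- exact: smooth_row_sum.
by congr N; apply: funext => y; rewrite big_cons.
Qed.

Lemma nablaE X Y x : smooth_on U X -> smooth_on U Y -> U x ->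
  N X Y x = 'D_(X x) Y x + Gam (X x) (Y x) x.
Proof.
move=> sX sY Ux.
have rE (Z : E -> E) : Z = (fun y => \sum_i Z y 0 i *: e_ i).
  by apply: funext => y; rewrite -row_sum_delta.
rewrite [in LHS](rE Y) N_sumr //; last by move=> i; apply: smooth_coord.
rewrite big_split /=; congr (_ + _).
  rewrite [RHS]row_sum_delta; apply: eq_bigr => i _.
  by rewrite (derive_coord _ _ (smooth_derivable sY Ux)).
rewrite /Gam exchange_big /=; apply: eq_bigr => j _.
rewrite [in LHS](rE X) N_suml //.
- by rewrite scaler_sumr; apply: eq_bigr => i _; rewrite scalerA mulrC.
- by move=> i; apply: smooth_coord.
- exact: smooth_cst.
Qed.

Section Multilinear.
Variables (p : nat) (f : (nat -> E) -> E -> R).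
Hypothesis f_lin : forall v i a u u' x, (i < p)%N -> U x ->
  f (upd v i (a *: u + u')) x = a * f (upd v i u) x + f (upd v i u') x.
Hypothesis f_smooth : forall v, smooth_on U (f v).

Lemma mlin_expand v i u x : (i < p)%N -> U x ->
  f (upd v i u) x = \sum_m u 0 m * f (upd v i (e_ m)) x.
Proof.
move=> ip Ux; rewrite {1}(row_sum_delta u).
elim: (index_enum _) => [|m r IH].
  rewrite !big_nil; have := @f_lin v i (-1) 0 0 x ip Ux.
  by rewrite scaler0 addr0 mulN1r addNr.
by rewrite !big_cons f_lin // IH.
Qed.

Lemma mlin_smooth_upd v i (Z : E -> E) : (i < p)%N -> smooth_on U Z ->
  smooth_on U (fun y => f (upd v i (Z y)) y).
Proof.
move=> ip sZ.
apply: (@smooth_on_eq _ _ U U_open _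
  (fun y => \sum_m Z y 0 m * f (upd v i (e_ m)) y)) => [y Uy|].
  by rewrite -mlin_expand.
by apply: smooth_sum => // m _; apply: smoothM => //; apply: smooth_coord.
Qed.

Let hyb j (Y : nat -> E -> E) (v : nat -> E) y : nat -> E :=
  fun i => if (i < j)%N then Y i y else v i.

Let hybS j Y v y : hyb j.+1 Y v y = upd (hyb j Y v y) j (Y j y).
Proof.
apply: funext => i; rewrite /hyb /upd ltnS leq_eqVlt.
by case: eqP => [->|].
Qed.

Let hyb_upd j Y v y u : hyb j Y (upd v j u) y = upd (hyb j Y v y) j u.
Proof.
apply: funext => i; rewrite /hyb /upd; case: eqP => [->|//].
by rewrite ltnn.
Qed.

(** Product rule, letting one slot vary at a time. Slot [j] is expanded in the standard basis, which
    leaves functions times fields with [j] variable slots; [v] is quantified inside the induction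
    because its entry [j] becomes a basis vector. *)
Lemma mlin_hybrid (Y : nat -> E -> E) j : (forall i, smooth_on U (Y i)) -> (j <= p)%N ->
  forall v, smooth_on U (fun y => f (hyb j Y v y) y) /\
  forall x w, U x -> 'D_w (fun y => f (hyb j Y v y) y) x =
    'D_w (f (hyb j Y v x)) x +
    \sum_(i < j) f (upd (hyb j Y v x) i ('D_w (Y i) x)) x.
Proof.
move=> sY; elim: j => [|j IH] jp v.
  have h0 y : hyb 0 Y v y = v by apply: funext => i; rewrite /hyb ltn0.
  have -> : (fun y => f (hyb 0 Y v y) y) = f v by apply: funext => y; rewrite h0.
  by split=> // x w Ux; rewrite big_ord0 addr0 h0.
have {}IH := IH (ltnW jp).
have E0 y : U y ->
    \sum_m Y j y 0 m * f (hyb j Y (upd v j (e_ m)) y) y = f (hyb j.+1 Y v y) y.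
  by move=> Uy; rewrite hybS mlin_expand //; apply: eq_bigr => m _; rewrite hyb_upd.
have sc m : smooth_on U (fun y => Y j y 0 m) by apply: smooth_coord.
have sm m : smooth_on U (fun y => Y j y 0 m * f (hyb j Y (upd v j (e_ m)) y) y).
  by apply: smoothM => //; case: (IH (upd v j (e_ m))).
split; first by apply: (smooth_on_eq U_open E0); apply: smooth_sum.
move=> x w Ux.
rewrite -(derive_eq_on U_open w E0 Ux) (derive_sum_seq U_open) //.
under eq_bigr => m _.
  have [sh Dh] := IH (upd v j (e_ m)).
  rewrite (@derive_mul _ _ U) // Dh // hyb_upd mulrDr mulr_sumr.
  rewrite (derive_coord _ _ (smooth_derivable (sY j) Ux)).
  over.
rewrite big_split /= -mlin_expand // big_split /= big_ord_recr /= hybS upd_upd.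
rewrite addrC -addrA; congr (_ + _).
  have E1 y : U y -> \sum_m Y j x 0 m * f (upd (hyb j Y v x) j (e_ m)) y =
      f (upd (hyb j Y v x) j (Y j x)) y.
    by move=> Uy; rewrite [RHS]mlin_expand.
  rewrite -(derive_eq_on U_open w E1 Ux) (derive_sum_seq U_open) //; last first.
    by move=> m; apply: smoothM => //; apply: smooth_cst.
  apply: eq_bigr => m _; rewrite (@derive_mul _ _ U) //; last exact: smooth_cst.
  by rewrite derive_cst mul0r add0r.
congr (_ + _); rewrite exchange_big /=; apply: eq_bigr => i _.
have ij : (i : nat) != j by rewrite neq_ltn ltn_ord.
rewrite (updC _ _ _ (_ : j != i)) 1?eq_sym // [RHS]mlin_expand //.
by apply: eq_bigr => m _; rewrite [in LHS]updC 1?eq_sym.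
Qed.

Hypothesis f_ext : forall v v' x, (forall i, (i < p)%N -> v i = v' i) -> f v x = f v' x.

Lemma mlin_derive (Y : nat -> E -> E) x w : (forall i, smooth_on U (Y i)) -> U x ->
  'D_w (fun y => f (Y ^~ y) y) x =
  'D_w (f (Y ^~ x)) x + \sum_(i < p) f (upd (Y ^~ x) i ('D_w (Y i) x)) x.
Proof.
move=> sY Ux; have [_ /(_ x w Ux)] := mlin_hybrid sY (leqnn p) (Y ^~ x).
have -> : (fun y => f (hyb p Y (Y ^~ x) y) y) = (fun y => f (Y ^~ y) y).
  by apply: funext => y; apply: f_ext => i ip; rewrite /hyb ip.
by have -> : hyb p Y (Y ^~ x) x = Y ^~ x by apply: funext => i; rewrite /hyb if_same.
Qed.

Lemma mlin_derive_upd v i (Z : E -> E) x w : (i < p)%N -> smooth_on U Z -> U x ->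
  'D_w (fun y => f (upd v i (Z y)) y) x =
  'D_w (f (upd v i (Z x))) x + f (upd v i ('D_w Z x)) x.
Proof.
move=> ip sZ Ux.
have E1 (z : E) y : U y -> \sum_m z 0 m * f (upd v i (e_ m)) y = f (upd v i z) y.
  by move=> Uy; rewrite [RHS]mlin_expand.
rewrite -(derive_eq_on U_open w (E1 (Z x)) Ux) -(E1 _ x Ux).
have E2 y : U y -> \sum_m Z y 0 m * f (upd v i (e_ m)) y = f (upd v i (Z y)) y.
  exact: E1.
have sc m : smooth_on U (fun y => Z y 0 m) by apply: smooth_coord.
rewrite -(derive_eq_on U_open w E2 Ux) !(derive_sum_seq U_open) //; last 2 first.
- by move=> m; apply: smoothM => //; apply: smooth_cst.
- by move=> m; apply: smoothM.
rewrite -big_split; apply: eq_bigr => m _ /=.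
rewrite !(@derive_mul _ _ U) //; last exact: smooth_cst.
rewrite derive_cst mul0r add0r addrC; congr (_ + _ * _).
by rewrite (derive_coord _ _ (smooth_derivable sZ Ux)).
Qed.

End Multilinear.
End LocalConnection.

(** * Iterated covariant derivatives as tensors *)

Section FrozenTensors.
Variables (R : realType) (n : nat).
Local Notation E := 'rV[R]_n.
Local Notation e_ i := (delta_mx 0 i : E).
Variable U : set E.
Hypothesis U_open : open U.
Variable N : (E -> E) -> (E -> E) -> (E -> E).
Hypothesis N_smooth : forall X Y, smooth_on U X -> smooth_on U Y -> smooth_on U (N X Y).
Hypothesis N_linear : forall (a : E -> R) X X' Y, smooth_on U a -> smooth_on U X ->
  smooth_on U X' -> smooth_on U Y -> forall x, U x ->
  N (fun y => a y *: X y + X' y) Y x = a x *: N X Y x + N X' Y x.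
Hypothesis N_leibniz : forall (a : E -> R) X Y Y', smooth_on U a -> smooth_on U X ->
  smooth_on U Y -> smooth_on U Y' -> forall x, U x ->
  N X (fun y => a y *: Y y + Y' y) x =
  'D_(X x) a x *: Y x + a x *: N X Y x + N X Y' x.
Variable om : E -> 'M[R]_n.
Hypothesis om_smooth : smooth_on U om.

Local Notation Gam := (Gam N).

(* nabla^k om evaluated on vectors instead of vector fields; slots beyond the
   (k+2)-th one are ignored *)
Fixpoint frozen k (v : nat -> E) (x : E) : R :=
  if k is k'.+1 then
    'D_(v 0) (frozen k' (fun i => v i.+1)) x -
    \sum_(i < k'.+2) frozen k' (upd (fun i => v i.+1) i (Gam (v 0) (v i.+1) x)) x
  else mxform (om x) (v 0) (v 1).

Lemma frozen_ext k v v' x : (forall i, (i < k.+2)%N -> v i = v' i) ->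
  frozen k v x = frozen k v' x.
Proof.
elim: k v v' x => [|k IH] v v' x vv' /=; first by rewrite !vv'.
have vv1 i : (i < k.+2)%N -> v i.+1 = v' i.+1 by move=> ik; apply: vv'.
congr (_ - _).
  rewrite (vv' 0%N) //; congr ('D_ _ _ x); apply: funext => y; exact: IH.
apply: eq_bigr => i _; apply: IH => j jk; rewrite /upd !vv1 // (vv' 0%N) //.
Qed.

Lemma smooth_mxform (A : E -> 'M[R]_n) u v : smooth_on U A ->
  smooth_on U (fun x => mxform (A x) u v).
Proof.
move=> sA.
apply: (@smooth_on_eq _ _ U U_open _ (fun x => \sum_i \sum_j (u 0 j * v 0 i) * A x j i)).
  move=> y _; rewrite /mxform mxE; apply: eq_bigr => i _.
  rewrite !mxE mulr_suml; apply: eq_bigr => j _; ring.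
apply: smooth_sum => // i _; apply: smooth_sum => // j _.
by apply: smoothM => //; [apply: smooth_cst|apply: smooth_coord].
Qed.

(** Each half of the induction needs the other: additivity of the derivative rests on smoothness,
    and smoothness on expanding [Gam] in a slot by linearity. *)
Lemma frozen_spec k :
  (forall v i a u u' x, (i < k.+2)%N -> U x -> frozen k (upd v i (a *: u + u')) x =
    a * frozen k (upd v i u) x + frozen k (upd v i u') x) /\
  (forall v, smooth_on U (frozen k v)).
Proof.
elim: k => [|k [IHl IHs]].
  split=> [v [|[|i]] a u u' x // _ Ux|v].
  - exact: mxform_linl.
  - exact: mxform_linr.
  - exact: smooth_mxform.
split=> [v i a u u' x ik Ux|v].
  pose v' j := v j.+1.
  case: i ik => [|i] ik.
    have e w : frozen k.+1 (upd v 0 w) x = 'D_w (frozen k v') x -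
        \sum_(j < k.+2) frozen k (upd v' j (Gam w (v' j) x)) x by [].
    rewrite !e derive_linear; last exact: smooth_differentiable (IHs _) Ux.
    rewrite (eq_bigr (fun j : 'I_k.+2 => a * frozen k (upd v' j (Gam u (v' j) x)) x +
      frozen k (upd v' j (Gam u' (v' j) x)) x)); last first.
      by move=> j _; rewrite Gam_linl IHl.
    by rewrite big_split -mulr_sumr /= /GRing.scale /=; ring.
  have e w : frozen k.+1 (upd v i.+1 w) x = 'D_(v 0) (frozen k (upd v' i w)) x -
      \sum_(j < k.+2) frozen k (upd (upd v' i w) j (Gam (v 0) (upd v' i w j) x)) x by [].
  have d : 'D_(v 0) (frozen k (upd v' i (a *: u + u'))) x =
      a * 'D_(v 0) (frozen k (upd v' i u)) x + 'D_(v 0) (frozen k (upd v' i u')) x.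
    have E1 y : U y -> a * frozen k (upd v' i u) y + frozen k (upd v' i u') y =
      frozen k (upd v' i (a *: u + u')) y by move=> Uy; rewrite IHl.
    rewrite -(derive_eq_on U_open _ E1 Ux).
    have sa := smoothM U_open (smooth_cst U_open a) (IHs (upd v' i u)).
    have D := deriveD (smooth_derivable (v := v 0) sa Ux)
      (smooth_derivable (v := v 0) (IHs (upd v' i u')) Ux).
    apply: (etrans D); congr (_ + _).
    apply: (etrans (derive_mul _ (smooth_cst U_open a) (IHs (upd v' i u)) Ux)).
    by rewrite derive_cst mul0r add0r.
  rewrite !e d (eq_bigr (fun j : 'I_k.+2 =>
    a * frozen k (upd (upd v' i u) j (Gam (v 0) (upd v' i u j) x)) x +
    frozen k (upd (upd v' i u') j (Gam (v 0) (upd v' i u' j) x)) x)); last first.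
    move=> j _; have [->|ji] := eqVneq (nat_of_ord j) i.
      by rewrite !upd_upd !upd_eq Gam_linr IHl.
    by rewrite !upd_neq // !(@updC _ _ i) 1?eq_sym // IHl.
  by rewrite big_split -mulr_sumr /=; ring.
apply: (@smooth_on_eq _ _ U U_open _ (fun x =>
    'D_(v 0) (frozen k (fun i => v i.+1)) x + (-1) *
    \sum_(i < k.+2) frozen k (upd (fun i => v i.+1) i (Gam (v 0) (v i.+1) x)) x)).
  by move=> y _; rewrite mulN1r.
apply: smoothD => //; first exact: smooth_derive.
apply: smoothM => //; first exact: smooth_cst.
apply: smooth_sum => // i _.
apply: (@mlin_smooth_upd _ _ U U_open k.+2 (frozen k) IHl IHs (fun i => v i.+1) i
  (Gam (v 0) (v i.+1))) => //.
exact: Gam_smooth.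
Qed.

Lemma frozen_lin k v i a u u' x : (i < k.+2)%N -> U x ->
  frozen k (upd v i (a *: u + u')) x =
  a * frozen k (upd v i u) x + frozen k (upd v i u') x.
Proof. exact: (frozen_spec k).1. Qed.

Lemma frozen_smooth k v : smooth_on U (frozen k v).
Proof. exact: (frozen_spec k).2. Qed.

Lemma frozenD k v i u u' x : (i < k.+2)%N -> U x ->
  frozen k (upd v i (u + u')) x = frozen k (upd v i u) x + frozen k (upd v i u') x.
Proof. by move=> ik Ux; rewrite -{1}(scale1r u) frozen_lin // mul1r. Qed.

Lemma frozenN k v i u x : (i < k.+2)%N -> U x ->
  frozen k (upd v i (- u)) x = - frozen k (upd v i u) x.
Proof.
move=> ik Ux; apply/eqP; rewrite -addr_eq0 -frozenD // addNr.
rewrite -[X in upd _ _ X](addNr u) -{1}scaleN1r frozen_lin // mulN1r addNr //.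
Qed.

(** Tensoriality: the derivatives of the argument fields produced by the product rule cancel against
    the derivative part of [N], and only [Gam] remains. *)
Lemma iter_nablaE k (Y : nat -> E -> E) x : (forall i, smooth_on U (Y i)) -> U x ->
  @iter_nabla_tensor R n N 2 k (two_tensor om) (fun i : 'I_(k + 2) => Y i) x =
  frozen k (Y ^~ x) x.
Proof.
elim: k Y x => [//|k IH] Y x sY Ux.
have IH' (Y' : nat -> E -> E) y : (forall i, smooth_on U (Y' i)) -> U y ->
   @iter_nabla_tensor R n N 2 k (two_tensor om) (fun i : 'I_(k + 2) => Y' i) y =
   frozen k (Y' ^~ y) y by apply: IH.
have sY1 i : smooth_on U (Y i.+1) by [].
rewrite /= /nabla_tensor.
have -> : (fun i : 'I_(k + 2) => Y (lift ord0 i)) = (fun i => Y i.+1) by [].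
have E0 y : U y -> @iter_nabla_tensor R n N 2 k (two_tensor om)
    (fun i : 'I_(k + 2) => Y i.+1) y = frozen k (fun i => Y i.+1 y) y.
  by move=> Uy; apply: (IH' (fun i => Y i.+1)).
rewrite (derive_eq_on U_open _ E0 Ux).
have D := @mlin_derive _ _ U U_open k.+2 (frozen k) (@frozen_lin k) (@frozen_smooth k)
  (@frozen_ext k) (fun i => Y i.+1) x (Y 0 x) sY1 Ux.
have -> : 'D_(Y 0 x) (fun y => frozen k (fun i => Y i.+1 y) y) x = _ := D.
pose G i := frozen k (upd (fun j => Y j.+1 x) i (N (Y 0) (Y i.+1) x)) x.
rewrite (eq_bigr (fun i : 'I_(k + 2) => G i)); last first.
  move=> i _; pose Z j := if j == i :> nat then N (Y 0) (Y i.+1) else Y j.+1.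
  have sZ j : smooth_on U (Z j).
    by rewrite /Z; case: eqP => // _; apply: N_smooth.
  apply: etrans (IH' Z x sZ Ux) _; rewrite /G; congr frozen.
  by apply: funext => j; rewrite /Z /upd; case: eqP.
have -> : \sum_(i < k + 2) G i = \sum_(i < k.+2) G i by rewrite addn2.
rewrite -addrA; congr (_ + _); rewrite -sumrB -sumrN; apply: eq_bigr => i _.
rewrite /G (nablaE U_open N_linear N_leibniz) // frozenD // opprD addrA subrr sub0r.
by [].
Qed.

End FrozenTensors.

(** * Ricci identity and structure equations *)

Section Alternation.
Variables (K : comNzRingType) (n : nat) (h S w : 'M[K]_n).
Implicit Types (f : (nat -> 'rV[K]_n) -> K) (s : nat -> 'rV[K]_n).

Definition alt j f s := f s - f (swp j s).

Fixpoint alt_iter j m f : (nat -> 'rV[K]_n) -> K :=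
  if m is m'.+1 then alt_iter j.+1 m' (alt j f) else f.

Definition curv_step p f s := - dact (gauss h S (s 0) (s 1)) p f (fun i => s i.+2).

(** The new operator depends only on the two slots in front, which this alternation leaves alone,
    and a derivation on all later slots commutes with swapping two of them. *)
Lemma curv_step_alt p f j : (j.*2.+1 < p)%N ->
  curv_step p (alt j f) = alt j.+1 (curv_step p f).
Proof.
move=> jp; apply: funext => s; rewrite /alt /curv_step.
have -> : (fun i => swp j.+1 s i.+2) = swp j (fun i => s i.+2) by apply: funext => -[|[|i]].
by rewrite dact_swp // -opprD /dact -sumrB.
Qed.

Lemma curv_step_alt_iter p m f j : ((j + m).*2 <= p)%N ->
  curv_step p (alt_iter j m f) = alt_iter j.+1 m (curv_step p f).
Proof.
elim: m j f => [//|m IH] j f jp /=.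
rewrite IH; last by rewrite addSnnS.
by rewrite curv_step_alt //; lia.
Qed.

(* The hypothesis on t is the Ricci identity: alternating two derivatives gives
   the action of the curvature. *)
Lemma curv_alternation (t : nat -> (nat -> 'rV[K]_n) -> K) m :
  t 0 = (fun s => mxform w (s 0) (s 1)) ->
  (forall k, alt 0 (t k.+2) = curv_step k.+2 (t k)) ->
  curv h S w m = alt_iter 0 m (t m.*2).
Proof.
move=> t0 ricci; elim: m => [|m IH]; first by rewrite t0.
transitivity (curv_step m.+1.*2 (curv h S w m)); first by apply: funext.
rewrite IH curv_step_alt_iter; last by lia.
exact: (congr1 (alt_iter 1 m) (esym (ricci m.*2))).
Qed.

Lemma alt_iter0 m j f : (forall s, f s = 0) -> forall s, alt_iter j m f s = 0.
Proof.
elim: m j f => [//|m IH] j f f0 s /=.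
by apply: IH => s'; rewrite /alt !f0 subrr.
Qed.

End Alternation.

Section Ricci.
Variables (R : realType) (n : nat).
Local Notation E := 'rV[R]_n.
Variable U : set E.
Hypothesis U_open : open U.
Variable N : (E -> E) -> (E -> E) -> (E -> E).
Hypothesis N_smooth : forall X Y, smooth_on U X -> smooth_on U Y -> smooth_on U (N X Y).
Variable om : E -> 'M[R]_n.
Hypothesis om_smooth : smooth_on U om.

Local Notation Gam := (Gam N).
Local Notation frozen := (frozen N om).
Let lin := frozen_lin U_open N_smooth om_smooth.
Let smo := frozen_smooth U_open N_smooth om_smooth.
Let linD := frozenD U_open N_smooth om_smooth.
Let linN := frozenN U_open N_smooth om_smooth.

Hypothesis torsion_free : forall u v x, U x -> Gam u v x = Gam v u x.

(** The bracket term is absent because [u] and [v] are constant fields. *)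
Definition curvature (u v z : E) (x : E) : E :=
  ('D_u (Gam v z) x + Gam u (Gam v z x) x) - ('D_v (Gam u z) x + Gam v (Gam u z x) x).

(** The terms are grouped for the alternation in [u] and [v]: what survives is the derivatives of
    [Gam] and the diagonal of the double sum, which together make up the curvature. *)
Lemma frozen2E k u v z x : U x ->
  frozen k.+2 (cons2 u v z) x =
  'D_u ('D_v (frozen k z)) x - frozen k.+1 (cons2 (Gam u v x) (z 0) (fun i => z i.+1)) x
  - \sum_(i < k.+2) ('D_u (frozen k (upd z i (Gam v (z i) x))) x
                     + 'D_v (frozen k (upd z i (Gam u (z i) x))) x
                     + frozen k (upd z i ('D_u (Gam v (z i)) x)) x)
  + \sum_(i < k.+2) \sum_(j < k.+2)
      frozen k (upd (upd z i (Gam u (z i) x)) j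
        (Gam v (upd z i (Gam u (z i) x) j) x)) x.
Proof.
move=> Ux.
have e1 y : frozen k.+1 (fun i => cons2 u v z i.+1) y =
    'D_v (frozen k z) y - \sum_(i < k.+2) frozen k (upd z i (Gam v (z i) y)) y by [].
have e2 : frozen k.+2 (cons2 u v z) x = 'D_u (frozen k.+1 (fun i => cons2 u v z i.+1)) x -
    (frozen k.+1 (cons2 (Gam u v x) (z 0) (fun i => z i.+1)) x +
     \sum_(i < k.+2) frozen k.+1 (fun j => cons2 u v (upd z i (Gam u (z i) x)) j.+1) x).
  transitivity ('D_u (frozen k.+1 (fun i => cons2 u v z i.+1)) x -
    \sum_(i < k.+3) frozen k.+1 (upd (fun i => cons2 u v z i.+1) i
      (Gam u (cons2 u v z i.+1) x)) x); first by [].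
  congr (_ - _); rewrite big_ord_recl; congr (_ + _).
    by congr frozen; apply: funext => -[|[|i]].
have sG i : smooth_on U (Gam v (z i)) by apply: Gam_smooth.
have su i : (i < k.+2)%N -> smooth_on U (fun y => frozen k (upd z i (Gam v (z i) y)) y).
  move=> ik.
  exact: (@mlin_smooth_upd _ _ U U_open k.+2 (frozen k) (@lin k) (smo k) z i _ ik (sG i)).
have D1 : 'D_u (frozen k.+1 (fun i => cons2 u v z i.+1)) x = 'D_u ('D_v (frozen k z)) x -
    \sum_(i < k.+2) 'D_u (fun y => frozen k (upd z i (Gam v (z i) y)) y) x.
  have sA : smooth_on U ('D_v (frozen k z)) by apply: smooth_derive; apply: smo.
  have sB : smooth_on U (fun y => \sum_(i < k.+2) frozen k (upd z i (Gam v (z i) y)) y).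
    by apply: smooth_sum => // i _; apply: su.
  have D := deriveB (smooth_derivable (v := u) sA Ux) (smooth_derivable (v := u) sB Ux).
  apply: (etrans D); congr (_ - _).
  by apply: (derive_sum_seq U_open) => // i; apply: su.
have D2 i : (i < k.+2)%N -> 'D_u (fun y => frozen k (upd z i (Gam v (z i) y)) y) x =
    'D_u (frozen k (upd z i (Gam v (z i) x))) x + frozen k (upd z i ('D_u (Gam v (z i)) x)) x.
  move=> ik.
  exact: (@mlin_derive_upd _ _ U U_open k.+2 (frozen k) (@lin k) (smo k) z i _ x u ik (sG i) Ux).
have e3 (i : 'I_k.+2) : frozen k.+1 (fun j => cons2 u v (upd z i (Gam u (z i) x)) j.+1) x =
    'D_v (frozen k (upd z i (Gam u (z i) x))) x -
    \sum_(j < k.+2) frozen k (upd (upd z i (Gam u (z i) x)) j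
        (Gam v (upd z i (Gam u (z i) x) j) x)) x by [].
rewrite e2 D1 (eq_bigr _ (fun i _ => e3 i)).
rewrite (eq_bigr _ (fun (i : 'I_k.+2) _ => D2 i (ltn_ord i))).
rewrite sumrB !big_split /=; ring.
Qed.

Lemma ricci_identity k u v z x : U x ->
  frozen k.+2 (cons2 u v z) x - frozen k.+2 (cons2 v u z) x =
  - dact (fun y => curvature u v y x) k.+2 (fun s => frozen k s x) z.
Proof.
move=> Ux; rewrite !frozen2E // (torsion_free v u Ux) (schwarz U_open (smo k z) v u Ux).
rewrite /dact.
have diag (i : 'I_k.+2) : frozen k (upd z i (curvature u v (z i) x)) x =
    frozen k (upd z i ('D_u (Gam v (z i)) x)) x + frozen k (upd z i (Gam u (Gam v (z i) x) x)) x
    - (frozen k (upd z i ('D_v (Gam u (z i)) x)) x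
       + frozen k (upd z i (Gam v (Gam u (z i) x) x)) x).
  have ik := ltn_ord i.
  by rewrite /curvature linD // linN // !linD.
rewrite (eq_bigr _ (fun (i : 'I_k.+2) _ => diag i)).
pose c a b (i j : 'I_k.+2) := frozen k (upd (upd z i (Gam a (z i) x)) j
        (Gam b (upd z i (Gam a (z i) x) j) x)) x.
(* For distinct slots the two insertions commute, so the off-diagonal terms cancel after exchanging
   [i] and [j]. *)
have cross : \sum_i \sum_j c u v i j - \sum_i \sum_j c v u i j =
  \sum_(i < k.+2) (frozen k (upd z i (Gam v (Gam u (z i) x) x)) x -
          frozen k (upd z i (Gam u (Gam v (z i) x) x)) x).
  rewrite [X in _ - X]exchange_big -sumrB; apply: eq_bigr => i _.
  rewrite -sumrB (bigD1 i) //= big1 ?addr0 => [|j ji].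
    by rewrite /c !upd_eq !upd_upd.
  have ji' : (j : nat) != i by [].
  rewrite /c upd_neq // [upd z j _ i]upd_neq 1?eq_sym //.
  by rewrite [X in _ - frozen _ X _]updC // subrr.
pose F a b (i : 'I_k.+2) := 'D_a (frozen k (upd z i (Gam b (z i) x))) x
  + 'D_b (frozen k (upd z i (Gam a (z i) x))) x
  + frozen k (upd z i ('D_a (Gam b (z i)) x)) x.
have outer (a b s1 s2 c1 c2 : R) :
    (a - b - s1 + c1) - (a - b - s2 + c2) = (c1 - c2) - (s1 - s2) by ring.
have inner (a b c1 c2 p q : R) :
    (p - q) - ((a + b + c1) - (b + a + c2)) = - (c1 + q - (c2 + p)) by ring.
apply: (etrans (outer _ _ (\sum_i F u v i) (\sum_i F v u i) _ _)).
rewrite -/(c u v) -/(c v u) cross -sumrB -sumrB -sumrN.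
by apply: eq_bigr => i _; apply: inner.
Qed.

End Ricci.

Section StructureEquations.
Variables (R : realType) (n : nat).
Local Notation E := 'rV[R]_n.
Local Notation e_ i := (delta_mx 0 i : E).
Variable U : set E.
Hypothesis U_open : open U.
Variable N : (E -> E) -> (E -> E) -> (E -> E).
Hypothesis N_smooth : forall X Y, smooth_on U X -> smooth_on U Y -> smooth_on U (N X Y).
Hypothesis N_linear : forall (a : E -> R) X X' Y, smooth_on U a -> smooth_on U X ->
  smooth_on U X' -> smooth_on U Y -> forall x, U x ->
  N (fun y => a y *: X y + X' y) Y x = a x *: N X Y x + N X' Y x.
Hypothesis N_leibniz : forall (a : E -> R) X Y Y', smooth_on U a -> smooth_on U X ->
  smooth_on U Y -> smooth_on U Y' -> forall x, U x ->
  N X (fun y => a y *: Y y + Y' y) x =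
  'D_(X x) a x *: Y x + a x *: N X Y x + N X Y' x.
Variables (F Xi : E -> 'rV[R]_n.+1) (H S : E -> 'M[R]_n) (tau : E -> 'cV[R]_n).
Hypotheses (sF : smooth_on U F) (sXi : smooth_on U Xi) (sH : smooth_on U H)
  (sS : smooth_on U S) (stau : smooth_on U tau).
Hypothesis transversal : forall x, U x -> forall u : 'rV[R]_n.+1,
  exists v c, u = 'd F x v + c *: Xi x.
Hypothesis gauss_F : forall X Y, smooth_on U X -> smooth_on U Y -> forall x, U x ->
  'D_(X x) (fun y => 'd F y (Y y)) x =
  'd F x (N X Y x) + mxform (H x) (X x) (Y x) *: Xi x.
Hypothesis weingarten_F : forall X, smooth_on U X -> forall x, U x ->
  'D_(X x) Xi x = - 'd F x (X x *m S x) + lform (tau x) (X x) *: Xi x.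

Local Notation Gam := (Gam N).

(** The pair of the differential and [Xi] is a surjective linear map between spaces of the same
    dimension n + 1, hence injective. *)
Lemma transversal_inj x v v' c c' : U x ->
  'd F x v + c *: Xi x = 'd F x v' + c' *: Xi x -> v = v' /\ c = c'.
Proof.
move=> Ux e.
pose A := col_mx (lin1_mx ('d F x)) (Xi x).
have AE u d : row_mx u d%:M *m A = 'd F x u + d *: Xi x.
  by rewrite mul_row_col mul_rV_lin1 mul_scalar_mx.
have full : row_full A.
  rewrite -sub1mx; apply/row_subP => i.
  have [u [d ->]] := transversal Ux (row i 1%:M).
  by rewrite -AE submxMl.
have free : row_free A by move: full; rewrite /row_full /row_free => /eqP ->; rewrite addn1.
have : row_mx v c%:M = row_mx v' c'%:M.
  by apply: (row_free_inj free); rewrite !AE.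
move=> /eq_row_mx[-> /(congr1 (fun B : 'M[R]_1 => B 0 0))].
by rewrite !mxE eqxx !mulr1n.
Qed.

Lemma smooth_diffF (Y : E -> E) : smooth_on U Y -> smooth_on U (fun y => 'd F y (Y y)).
Proof.
move=> sY; apply: smooth_rowP => // j.
apply: (@smooth_on_eq _ _ U U_open _
  (fun y => \sum_m Y y 0 m * ('D_(e_ m) F y) 0 j)) => [y Uy|].
  rewrite {2}(row_sum_delta (Y y)) linear_sum summxE; apply: eq_bigr => m _.
  rewrite linearZ mxE deriveE //; exact: smooth_differentiable sF Uy.
apply: smooth_sum => // m _; apply: smoothM => //; first exact: smooth_coord.
by apply: smooth_coord => //; apply: smooth_derive.
Qed.

Lemma gauss_cst (Y : E -> E) w x : smooth_on U Y -> U x ->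
  'D_w (fun y => 'd F y (Y y)) x =
  'd F x ('D_w Y x + Gam w (Y x) x) + mxform (H x) w (Y x) *: Xi x.
Proof.
move=> sY Ux.
have G := gauss_F (smooth_cst U_open w) sY Ux.
by apply: (etrans G); rewrite (nablaE U_open N_linear N_leibniz (smooth_cst U_open w) sY Ux).
Qed.

Lemma second_derive u v x : U x ->
  'D_u ('D_v F) x = 'd F x (Gam u v x) + mxform (H x) u v *: Xi x.
Proof.
move=> Ux; have G := gauss_cst u (smooth_cst U_open v) Ux.
rewrite derive_cst add0r in G; apply: etrans G.
apply: derive_eq_on Ux => // y Uy.
by rewrite deriveE //; apply: smooth_differentiable sF Uy.
Qed.

(** Second derivatives of [F] commute; the claims are the tangential and transversal parts of
    this. *)
Lemma second_form_sym u v x : U x ->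
  Gam u v x = Gam v u x /\ mxform (H x) u v = mxform (H x) v u.
Proof.
move=> Ux; apply: (transversal_inj Ux).
have e1 := second_derive u v Ux; have e2 := second_derive v u Ux.
exact: etrans (esym e1) (etrans (schwarz_row U_open u v sF Ux) e2).
Qed.

Lemma weingarten_cst w x : U x ->
  'D_w Xi x = - 'd F x (w *m S x) + lform (tau x) w *: Xi x.
Proof. by move=> Ux; apply: (weingarten_F (smooth_cst U_open w) Ux). Qed.

(** The tangential part of the commutation of the derivatives along [w] and [u] applied to the
    derivative of [F] along [v]. *)
Lemma gauss_equation w u v x : U x -> curvature N w u v x = gauss (H x) (S x) w u v.
Proof.
move=> Ux.
have third a b : 'D_a ('D_b ('D_v F)) x =
   'd F x ('D_a (Gam b v) x + Gam a (Gam b v x) x - mxform (H x) b v *: (a *m S x)) +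
   (mxform (H x) a (Gam b v x) + 'D_a (fun y => mxform (H y) b v) x +
    mxform (H x) b v * lform (tau x) a) *: Xi x.
  have sG : smooth_on U (Gam b v) by apply: Gam_smooth.
  have s1 := smooth_diffF sG.
  have sh : smooth_on U (fun y => mxform (H y) b v) by apply: smooth_mxform.
  have s2 : smooth_on U (fun y => mxform (H y) b v *: Xi y).
    apply: smooth_rowP => // j.
    apply: (smooth_on_eq U_open _ (smoothM U_open sh (smooth_coord U_open 0 j sXi))).
    by move=> y _; rewrite mxE.
  have E0 y : U y -> 'D_b ('D_v F) y = 'd F y (Gam b v y) + mxform (H y) b v *: Xi y.
    by move=> Uy; apply: second_derive.
  apply: (etrans (derive_eq_on U_open a E0 Ux)).
  have D := deriveD (smooth_derivable (v := a) s1 Ux) (smooth_derivable (v := a) s2 Ux).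
  apply: (etrans D); have G1 := gauss_cst a sG Ux.
  have G2 := derive_scale U_open a sh sXi Ux.
  rewrite weingarten_cst // in G2.
  apply: (etrans (congr2 +%R G1 G2)).
  by rewrite [in RHS]linearB linearZ /=; apply/rowP => j; rewrite !mxE; ring.
have /(transversal_inj Ux)[e _] := etrans (esym (third w u))
  (etrans (schwarz_row U_open w u (smooth_derive v sF) Ux) (third u w)).
rewrite /curvature /gauss; move/rowP: e => e; apply/rowP => j.
by have := e j; rewrite !mxE; lra.
Qed.

Hypothesis tau_closed : forall x, U x -> forall i j : 'I_n,
  'D_(e_ i) (fun y => tau y j 0) x - 'D_(e_ j) (fun y => tau y i 0) x = 0.

(** The transversal part of the symmetry of the second derivatives of [Xi]. On coordinate vectors
    the derivatives of [tau] cancel since [tau] is closed; bilinearity does the rest. *)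
Lemma shape_selfadjoint x u v : U x ->
  mxform (H x) (u *m S x) v = mxform (H x) u (v *m S x).
Proof.
move=> Ux.
have sl b : smooth_on U (fun y => lform (tau y) b).
  apply: (@smooth_on_eq _ _ U U_open _ (fun y => \sum_m b 0 m * tau y m 0)).
    by move=> y _; rewrite /lform mxE.
  apply: smooth_sum => // m _; apply: smoothM => //; first exact: smooth_cst.
  exact: smooth_coord.
have sY (b : E) : smooth_on U (fun y => b *m S y).
  apply: smooth_rowP => // j.
  apply: (@smooth_on_eq _ _ U U_open _ (fun y => \sum_m b 0 m * S y m j)).
    by move=> y _; rewrite mxE.
  apply: smooth_sum => // m _; apply: smoothM => //; first exact: smooth_cst.
  exact: smooth_coord.
have second (a b : E) : 'D_a ('D_b Xi) x =
   'd F x (- ('D_a (fun y => b *m S y) x + Gam a (b *m S x) x) -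
     lform (tau x) b *: (a *m S x)) +
   (- mxform (H x) a (b *m S x) + 'D_a (fun y => lform (tau y) b) x +
    lform (tau x) b * lform (tau x) a) *: Xi x.
  have s1 := smooth_diffF (sY b).
  have s1' : smooth_on U (fun y => - 'd F y (b *m S y) : 'rV[R]_n.+1).
    apply: smooth_rowP => // j.
    apply: (@smooth_on_eq _ _ U U_open _ (fun y => (-1) * 'd F y (b *m S y) 0 j)).
      by move=> y _; rewrite mxE mulN1r.
    by apply: smoothM => //; [apply: smooth_cst|apply: smooth_coord].
  have s2 : smooth_on U (fun y => lform (tau y) b *: Xi y).
    apply: smooth_rowP => // j.
    apply: (smooth_on_eq U_open _ (smoothM U_open (sl b) (smooth_coord U_open 0 j sXi))).
    by move=> y _; rewrite mxE.
  have E0 y : U y -> 'D_b Xi y = - 'd F y (b *m S y) + lform (tau y) b *: Xi y.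
    by move=> Uy; apply: weingarten_cst.
  apply: (etrans (derive_eq_on U_open a E0 Ux)).
  have D := deriveD (smooth_derivable (v := a) s1' Ux) (smooth_derivable (v := a) s2 Ux).
  have D' := deriveN (smooth_derivable (v := a) s1 Ux).
  have G1 := etrans D' (congr1 -%R (gauss_cst a (sY b) Ux)).
  have G2 := derive_scale U_open a (sl b) sXi Ux.
  rewrite weingarten_cst // in G2.
  apply: (etrans D); apply: (etrans (congr2 +%R G1 G2)).
  by rewrite [in RHS]linearB linearN linearZ /=; apply/rowP => j; rewrite !mxE; ring.
have onb i j : mxform (H x) (e_ i *m S x) (e_ j) = mxform (H x) (e_ i) (e_ j *m S x).
  have /(transversal_inj Ux)[_ e] := etrans (esym (second (e_ i) (e_ j)))
    (etrans (schwarz_row U_open (e_ i) (e_ j) sXi Ux) (second (e_ j) (e_ i))).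
  have lfE k : (fun y => lform (tau y) (e_ k)) = (fun y => tau y k 0).
    by apply: funext => y; rewrite /lform -rowE !mxE.
  have := tau_closed Ux i j; rewrite !lfE in e => /eqP; rewrite subr_eq0 => /eqP cl.
  rewrite (second_form_sym (e_ i *m S x) (e_ j) Ux).2.
  move: e; rewrite cl; set d := 'D_ _ _ _; set p := lform _ _; set q := lform _ _.
  by move=> e; lra.
have hS X Y : mxform (H x) (X *m S x) Y = mxform (S x *m H x) X Y.
  by rewrite /mxform !mulmxA.
have hS' X Y : mxform (H x) X (Y *m S x) = mxform (H x *m (S x)^T) X Y.
  by rewrite /mxform trmx_mul !mulmxA.
rewrite hS hS'; congr (mxform _ u v); apply/matrixP => i j.
by rewrite -!mxform_delta -hS -hS' onb.
Qed.

End StructureEquations.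

(** * From the hypersurface to a single tangent space *)

Lemma frozen_vanish (R : realType) n (U : set 'rV[R]_n) (N : _ -> _ -> 'rV[R]_n -> 'rV[R]_n)
    (om : 'rV[R]_n -> 'M[R]_n) k r : open U ->
  (forall v x, U x -> frozen N om k v x = 0) ->
  forall v x, U x -> frozen N om (r + k) v x = 0.
Proof.
move=> U_open f0; elim: r => [//|r IH] v x Ux.
rewrite addSn /= big1 ?subr0 => [|i _]; last exact: IH.
have E0 y : U y -> frozen N om (r + k) (fun i => v i.+1) y = cst 0 y by apply: IH.
by rewrite (derive_eq_on U_open _ E0 Ux) derive_cst.
Qed.

Theorem theorem3p16 (R : realType) (M : manifold R 4)
    (f xi : M -> 'rV[R]_5) (nab : connection M) (h : bilinear_field M)
    (S : endo_field M) (tau : one_form M) (omega : bilinear_field M)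
    (k : nat) :
  connected [set: M] ->
  orientable M ->
  immersion f ->
  transversal_field f xi ->
  gauss_formula f xi nab h ->
  weingarten_formula f xi S tau ->
  nondegenerate_field h ->
  closed_one_form tau ->
  almost_symplectic omega ->
  (1 <= k)%N ->
  iter_nabla_vanishes nab omega k ->
  lorentzian h ->
  forall phi : chart R 4 M, atlas phi ->
    forall x : 'rV[R]_4, chart_img phi x -> (\rank (S phi x) <= 1)%N.
Proof.
move=> _ _ [sf _] [sxi tr] gauss weing h_nd tau_closed [om_alt om_nd] _ van lor phi aphi x Ux.
pose U := chart_img phi.
have U_open : open U := @chart_img_open _ _ _ phi.
have N_smooth X Y : smooth_on U X -> smooth_on U Y -> smooth_on U (nab phi X Y).
  exact: nabla_smooth.
have N_linear (a : 'rV[R]_4 -> R) X X' Y : smooth_on U a -> smooth_on U X ->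
  smooth_on U X' -> smooth_on U Y -> forall y, U y ->
  nab phi (fun z => a z *: X z + X' z) Y y = a y *: nab phi X Y y + nab phi X' Y y.
  exact: nabla_linear.
have N_leibniz (a : 'rV[R]_4 -> R) X Y Y' : smooth_on U a -> smooth_on U X ->
  smooth_on U Y -> smooth_on U Y' -> forall y, U y ->
  nab phi X (fun z => a z *: Y z + Y' z) y =
  'D_(X y) a y *: Y y + a y *: nab phi X Y y + nab phi X Y' y.
  exact: nabla_leibniz.
have sF := sf phi aphi; have sXi := sxi phi aphi.
have sH := bilinear_smooth h aphi; have sS := endo_smooth S aphi.
have stau := one_form_smooth tau aphi; have som := bilinear_smooth omega aphi.
have trans := tr phi aphi.
have gaussU := gauss phi aphi; have weingU := weing phi aphi.
have sym := second_form_sym U_open N_linear N_leibniz sF trans gaussU.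
have geq := gauss_equation U_open N_smooth N_linear N_leibniz sF sXi sH trans gaussU weingU.
have self := shape_selfadjoint U_open N_linear N_leibniz sF sXi sS stau trans
  gaussU weingU (tau_closed phi aphi).
have van0 v y : U y -> frozen (nab phi) (omega phi) k v y = 0.
  move=> Uy.
  have sv i : smooth_on U (fun=> v i : 'rV[R]_4) by apply: smooth_cst.
  have e := @iter_nablaE _ _ _ U_open _ N_smooth N_linear N_leibniz _ som k
    (fun i _ => v i) y sv Uy.
  exact: etrans (esym e) (van phi aphi (fun i _ => v i) (fun i => sv i) y Uy).
(* [k] curvature operators consume 2k derivatives, so the vanishing at order [k] is first propagated
   to order 2k. *)
have van2 v : frozen (nab phi) (omega phi) k.*2 v x = 0.
  by rewrite -addnn; apply: frozen_vanish Ux.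
have [P Pu Pd] := lor phi aphi x Ux.
apply: (@curv_rank R (h phi x) (S phi x) (omega phi x) P k) => //.
- by move=> X Y; case: (sym X Y x Ux).
- exact: (h_nd phi aphi x Ux).
- by move=> X Y; apply: self.
- exact: (om_alt phi aphi x Ux).
- exact: (om_nd phi aphi x Ux).
have -> := @curv_alternation _ _ (h phi x) (S phi x) (omega phi x)
  (fun j s => frozen (nab phi) (omega phi) j s x) k erefl.
  exact: alt_iter0.
move=> j; apply: funext => s; rewrite (cons2_eta s) /alt swp_cons2_0.
apply: (etrans (ricci_identity U_open N_smooth som _ j _ _ _ Ux)).
  by move=> u v y Uy; case: (sym u v y Uy).
rewrite /curv_step /dact; congr (- _); apply: eq_bigr => i _.
by rewrite (geq _ _ _ _ Ux).
Qed.
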